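(* $\mathrm{NP} \subseteq \mathrm{C_{=}P}$ if and only if $\mathrm{P}^{\mathrm{NP}}_{||} \subseteq \mathrm{C_{=}P}$.
   Context: $\mathrm{NP}$ is the class of languages accepted by nondeterministic polynomial-time Turing machines. $\mathrm{P}^{\mathrm{NP}}_{||}$ is the class of languages decidable by a deterministic polynomial-time Turing machine with parallel (non-adaptive) access to an NP oracle: on input $x$ the machine first computes a list of queries, submits the whole list at once to an oracle set in $\mathrm{NP}$, receives the list of yes/no answers, and then decides membership of $x$ in polynomial time. $\mathrm{C_{=}P}$ (exact counting polynomial time) is the class of languages $L$ for which there exist a polynomial-time computable function $f$ and a nondeterministic polynomial-time Turing machine $N$ such that for every input $x$, $x \in L$ if and only if $N$ on input $x$ has exactly $f(x)$ accepting computation paths. *)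

(* Defs.v *)
From mathcomp Require Import all_boot.
Set Implicit Arguments. Unset Strict Implicit. Unset Printing Implicit Defensive.

Definition word := seq bool.
Definition language := word -> Prop.

(* Tape symbols: None = blank, Some b = bit b. *)
Definition sym := option bool.

(* A (possibly nondeterministic) single-tape Turing machine with a two-way
   infinite tape.  delta q a is the SET of possible moves
   (new state, written symbol, direction: true = right, false = left). *)
Record NTM := {
  st : finType;
  start : st;
  qacc : st;
  qrej : st;
  delta : st -> sym -> {set (st * sym * bool)}
}.

(* configuration: state, tape left of head (nearest first), scanned
   symbol, tape right of head (nearest first); blanks beyond the lists. *)
Definition config (M : NTM) := (st M * seq sym * sym * seq sym)%type.

Definition init (M : NTM) (x : word) : config M :=
  match x with
  | [::] => (@start M, [::], None, [::])
  | b :: x' => (@start M, [::], Some b, map Some x')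
  end.

Definition apply_move (M : NTM) (c : config M) (t : st M * sym * bool)
  : config M :=
  let: (_, l, _, r) := c in
  let: (q', b, d) := t in
  if d then
    match r with
    | [::] => (q', b :: l, None, [::])
    | s :: r' => (q', b :: l, s, r')
    end
  else
    match l with
    | [::] => (q', [::], None, b :: r)
    | s :: l' => (q', l', s, b :: r)
    end.

Definition halted (M : NTM) (c : config M) : bool :=
  let: (q, _, _, _) := c in (q == @qacc M) || (q == @qrej M).

Definition succs (M : NTM) (c : config M) : seq (config M) :=
  let: (q, _, a, _) := c in [seq apply_move c t | t <- enum (@delta M q a)].

(* every computation path from c halts within t steps
   (a non-halting configuration without moves is a rejecting dead end) *)
Fixpoint halts_within (M : NTM) (t : nat) (c : config M) : Prop :=
  halted c \/
  match t with
  | 0 => succs c = [::]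
  | t'.+1 => forall c', c' \in succs c -> halts_within t' c'
  end.

Fixpoint nacc (M : NTM) (t : nat) (c : config M) : nat :=
  let: (q, _, _, _) := c in
  if q == @qacc M then 1
  else if q == @qrej M then 0
  else match t with
       | 0 => 0
       | t'.+1 => sumn (map (nacc t') (succs c))
       end.

Definition deterministic (M : NTM) : Prop :=
  forall q a, #|@delta M q a| <= 1.

Fixpoint drun (M : NTM) (t : nat) (c : config M) : config M :=
  if halted c then c else
  match t with
  | 0 => c
  | t'.+1 => match succs c with
             | [::] => c
             | c' :: _ => drun t' c'
             end
  end.

Fixpoint bits_until_blank (s : seq sym) : word :=
  match s with
  | Some b :: s' => b :: bits_until_blank s'
  | _ => [::]
  end.

Definition output (M : NTM) (c : config M) : word :=
  let: (_, _, a, r) := c in bits_until_blank (a :: r).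

Definition nat_of_bits (w : word) : nat :=
  foldl (fun n (b : bool) => n.*2 + b) 0 w.

Definition poly_bound (T : nat -> nat) : Prop :=
  exists c k, forall n, T n <= c * n ^ k + c.

Definition runs_in (M : NTM) (T : nat -> nat) : Prop :=
  forall x, halts_within (T (size x)) (init M x).

Definition inP (L : language) : Prop :=
  exists (M : NTM) (T : nat -> nat),
    [/\ deterministic M, poly_bound T, runs_in M T &
        forall x, L x <-> 0 < nacc (T (size x)) (init M x)].

Definition inNP (L : language) : Prop :=
  exists (M : NTM) (T : nat -> nat),
    [/\ poly_bound T, runs_in M T &
        forall x, L x <-> 0 < nacc (T (size x)) (init M x)].

Definition FP_word (f : word -> word) : Prop :=
  exists (M : NTM) (T : nat -> nat),
    [/\ deterministic M, poly_bound T, runs_in M T &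
        forall x, output (drun (T (size x)) (init M x)) = f x].

Definition FP_nat (f : word -> nat) : Prop :=
  exists g : word -> word, FP_word g /\ forall x, nat_of_bits (g x) = f x.

Definition inCeqP (L : language) : Prop :=
  exists (f : word -> nat) (N : NTM) (T : nat -> nat),
    [/\ FP_nat f, poly_bound T, runs_in N T &
        forall x, L x <-> nacc (T (size x)) (init N x) = f x].

Definition dbl (w : word) : word := flatten [seq [:: b; b] | b <- w].
Definition enc_list (ws : seq word) : word :=
  flatten [seq dbl w ++ [:: false; true] | w <- ws].
Definition enc_pair (x y : word) : word := dbl x ++ [:: false; true] ++ y.

(* P^NP_|| : polynomial-time query generator g, NP oracle A, and a
   polynomial-time final decision D on (x, vector of oracle answers). *)
Definition inPNPpar (L : language) : Prop :=
  exists (g : word -> seq word) (A D : language),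
    [/\ FP_word (fun x => enc_list (g x)), inNP A, inP D &
        forall x, exists ans : seq bool,
          size ans = size (g x) /\
          (forall i, i < size ans -> (A (nth [::] (g x) i) <-> nth false ans i)) /\
          (L x <-> D (enc_pair x ans))].

(* Main.v *)
(** Suppose NP is contained in C_=P, and let [L] be decided by [D] from the input
    [x] and the answers to parallel queries [q_1 .. q_n] to a set [A] in NP. An
    answer vector [ans] is the correct one iff all its positive answers are
    certified by accepting paths for [A] and no query answered negatively is in
    [A]. That some query of a list [Z] is in [A] is an NP property of [Z], hence
    equivalent to [c Z = v Z] for a #P function [c] and an FP function [v]. With
    [Z] the list of the queries that [ans] answers negatively, [x \in L] iff the
    sum, over all [ans] rejected by [D], of
    [\prod_(i | ans_i) acc_A q_i * (c Z - v Z) ^ 2] vanishes. Expanding the square separates the positive and the negative terms: [x \in L]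
    iff two #P functions of [x] agree. Finally [h1 x = h2 x] iff
    [h1 x + (B - h2 x) = B], where [B] is a polynomial-time computable bound that
    is large enough for a clocked machine to have exactly [B - h2 x] accepting
    paths; this puts [L] in C_=P.

    Turing machines are programmed through machines with eight stacks, which are
    compiled to single-tape machines; fragments of stack machines compose like
    programs (sequence, loop, nondeterministic guess), and one of the fragments
    simulates a given Turing machine on two of the stacks. *)

From HB Require Import structures.
Require Import Defs.
From mathcomp Require Import all_boot ssralg ssrint zify.
Set Implicit Arguments. Unset Strict Implicit. Unset Printing Implicit Defensive.

(** * Stack machines *)

(** At most one term of the sum is nonzero. An uncertified positive answer makes the product zero,
    and a missed member of [A] makes [c Z = v Z]; the correct vector keeps a positive weight, and it
    is present exactly when [D] rejects. Summing over the rejected vectors turns membership into the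
    vanishing of a sum, which an equality of counts can express. Squaring makes every term
    nonnegative, so the two sums are compared term by term, through an inequality with its equality
    case. The sign of a path is a boolean that is flipped at each factor [v Z]; its two initial
    values give the two #P functions.

    What shapes the machine part is that path counts must be exact. A run is therefore described by
    the list of its outcomes with repetitions, and sequencing becomes flattening. The moves of a
    Turing machine form a set, so equal choices would merge unless the control state keeps them
    apart. Times are only upper bounds, and all statements are stable under enlarging them. *)

Notation stack := 'I_8.
Definition store := seq word.
Definition get (s : store) (i : stack) : word := nth [::] s i.
Definition put (s : store) (i : stack) (w : word) : store := set_nth [::] s i w.

Inductive instr (T : Type) :=
| Push of stack & bool & T
| Pop of stack & (option bool -> T)
| Choose of seq T.

Definition imap (T U : Type) (h : T -> U) (c : instr T) : instr U :=
  match c with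
  | Push i b z => Push i b (h z)
  | Pop i k => Pop i (h \o k)
  | Choose zs => Choose (map h zs)
  end.

(** The exits carry a returned value, as in a state monad. This value becomes part of the control
    state of the continuation, hence [X] is finite; unbounded data stay on the stacks. *)
Record frag (X : finType) := Frag {
  fq : finType;
  fentry : fq;
  fcode : fq -> instr (fq + X)
}.

Section Semantics.
Variables (Q X : eqType) (code : Q -> instr (Q + X)).

Fixpoint halts (t : nat) (z : Q + X) (s : store) : bool :=
  match z with
  | inr _ => true
  | inl q =>
    if t isn't t'.+1 then false else
    match code q with
    | Push i b z' => halts t' z' (put s i (b :: get s i))
    | Pop i k => halts t' (k (ohead (get s i))) (put s i (behead (get s i)))
    | Choose zs => all (fun z' => halts t' z' s) zs
    end
  end.

(** One entry per path, with repetitions. A path that runs out of fuel leaves no entry, so the list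
    is meaningful only together with [halts]. *)
Fixpoint run (t : nat) (z : Q + X) (s : store) : seq (X * store) :=
  match z with
  | inr x => [:: (x, s)]
  | inl q =>
    if t isn't t'.+1 then [::] else
    match code q with
    | Push i b z' => run t' z' (put s i (b :: get s i))
    | Pop i k => run t' (k (ohead (get s i))) (put s i (behead (get s i)))
    | Choose zs => flatten [seq run t' z' s | z' <- zs]
    end
  end.

Lemma run_mono t t' z s : t <= t' -> halts t z s ->
  halts t' z s /\ run t' z s = run t z s.
Proof.
elim: t t' z s => [|t IH] [|t'] [q|x] s //= tt'.
case: (code q) => [i b z|i k|zs]; [exact: IH|exact: IH|].
move=> /allP H; split.
  by apply/allP => z zz; have [] := IH t' z s tt' (H z zz).
by congr flatten; apply/eq_in_map => z zz; have [] := IH t' z s tt' (H z zz).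
Qed.

End Semantics.

(** Sequencing and looping both place the code of a fragment inside larger code and redirect its
    exits, so they share this simulation argument. *)
Lemma run_embed (Q X Q' X' : eqType) (code : Q -> instr (Q + X))
    (code' : Q' -> instr (Q' + X')) (e : Q -> Q') (lift : Q + X -> Q' + X') :
    (forall q, lift (inl q) = inl (e q)) ->
    (forall q, code' (e q) = imap lift (code q)) ->
  forall t1 t2 z s, halts code t1 z s ->
  (forall y, y \in run code t1 z s -> halts code' t2 (lift (inr y.1)) y.2) ->
  halts code' (t1 + t2) (lift z) s /\
  run code' (t1 + t2) (lift z) s =
    flatten [seq run code' t2 (lift (inr y.1)) y.2 | y <- run code t1 z s].
Proof.
move=> le ce; elim=> [|t1 IH] t2 [q|x] s //=.
- by move=> _ H; rewrite cats0 add0n; split=> //; apply: (H (x, s)); rewrite inE.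
- rewrite le ?addSn /= ce; case: (code q) => [i b z|i k|zs] /=;
    [exact: IH|exact: IH|].
  move=> /allP hz hy.
  have A z : z \in zs -> halts code' (t1 + t2) (lift z) s /\
     run code' (t1 + t2) (lift z) s =
     flatten [seq run code' t2 (lift (inr y.1)) y.2 | y <- run code t1 z s].
    move=> zz; apply: IH; first exact: hz.
    by move=> y yi; apply: hy; apply/flattenP; exists (run code t1 z s) => //; apply/mapP; exists z.
  split; first by rewrite all_map; apply/allP => z /A [].
  rewrite -map_comp; elim: zs {hz hy} A => //= z zs IHz A.
  rewrite map_cat flatten_cat IHz => [|z' zz'].
    by have [_ ->] := A z (mem_head _ _).
  by apply: A; rewrite inE zz' orbT.
- move=> _ H; rewrite cats0; have h := H _ (mem_head _ _).
  by have [] := run_mono (leq_addl t1.+1 t2) h.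
Qed.

Definition exec X (f : frag X) s t o :=
  halts (@fcode _ f) t (inl (fentry f)) s /\ run (@fcode _ f) t (inl (fentry f)) s = o.

Definition cnt (f : frag bool) s t n :=
  exists2 o, exec f s t o & count fst o = n.

Definition push i b : frag unit :=
  @Frag unit unit tt (fun _ => Push i b (inr tt)).
Definition pop i : frag (option bool) :=
  @Frag (option bool) unit tt (fun _ => Pop i inr).
Definition guess (X : finType) (xs : seq X) : frag X :=
  @Frag X unit tt (fun _ => Choose (map inr xs)).
Definition ret (X : finType) (x : X) : frag X := guess [:: x].

Section Bind.
Variables (X Y : finType) (f : frag X) (g : X -> frag Y).

(** One copy of the code of [g x] for every value [x]: the copy in which the control is remembers
    the value that [f] returned. *)
Definition bind_q : finType := (fq f + {x : X & fq (g x)})%type.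
Definition bind_in (x : X) (z : fq (g x) + Y) : bind_q + Y :=
  match z with inl q => inl (inr (Tagged (fun x => fq (g x)) q)) | inr y => inr y end.
Definition bind_out (z : fq f + X) : bind_q + Y :=
  match z with inl q => inl (inl q) | inr x => bind_in (inl (fentry (g x))) end.
Definition bind_code (q : bind_q) : instr (bind_q + Y) :=
  match q with
  | inl q => imap bind_out (fcode q)
  | inr (existT x q) => imap (@bind_in x) (fcode q)
  end.
Definition bind := Frag (inl (fentry f) : bind_q) bind_code.

Lemma exec_bind s t1 t2 o h :
  exec f s t1 o -> {in o, forall y, exec (g y.1) y.2 t2 (h y)} ->
  exec bind s (t1 + t2) (flatten (map h o)).
Proof.
move=> [h1 r1] hg.
have G y : y \in o ->
    halts bind_code t2 (bind_in (inl (fentry (g y.1)))) y.2 /\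
    run bind_code t2 (bind_in (inl (fentry (g y.1)))) y.2 = h y.
  move=> /hg [hy ry].
  have [|] := @run_embed _ _ _ _ (@fcode _ (g y.1)) bind_code
    (fun q => inr (Tagged (fun x => fq (g x)) q)) (@bind_in y.1)
    (fun q => erefl) (fun q => erefl) t2 0 _ _ hy.
    by [].
  rewrite addn0 => -> ->; split=> //; rewrite ry.
  by elim: (h y) => //= -[a b] l ->.
have [|] := @run_embed _ _ _ _ (@fcode _ f) bind_code inl bind_out
    (fun q => erefl) (fun q => erefl) t1 t2 _ _ h1.
  by rewrite r1 => y /G [].
rewrite r1 => H1 H2; split; first exact: H1.
rewrite [LHS]H2; congr flatten; apply/eq_in_map => y /G [_ <-] //.
Qed.

End Bind.

Section Loop.
Variables (A Y : finType) (f : A -> frag (A + Y)%type).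

Definition loop_q : finType := {a : A & fq (f a)}.
Definition loop_at (a : A) (q : fq (f a)) : loop_q := Tagged (fun a => fq (f a)) q.
Definition loop_lift (a : A) (z : fq (f a) + (A + Y)) : loop_q + Y :=
  match z with
  | inl q => inl (loop_at q)
  | inr (inl a') => inl (loop_at (fentry (f a')))
  | inr (inr y) => inr y
  end.
Definition loop_code (q : loop_q) : instr (loop_q + Y) :=
  let: existT a q := q in imap (@loop_lift a) (fcode q).
Definition loop (a : A) := Frag (loop_at (fentry (f a))) loop_code.

Lemma exec_loop a s t1 t2 o h :
  exec (f a) s t1 o ->
  {in o, forall y, match y.1 with
     | inl a' => exec (loop a') y.2 t2 (h y)
     | inr b => h y = [:: (b, y.2)] end} ->
  exec (loop a) s (t1 + t2) (flatten (map h o)).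
Proof.
move=> [h1 r1] hg.
have G y : y \in o ->
    halts loop_code t2 (loop_lift (inr y.1 : fq (f a) + (A + Y))) y.2 /\
    run loop_code t2 (loop_lift (inr y.1 : fq (f a) + (A + Y))) y.2 = h y.
  by move=> /hg; case: y => -[a'|b] s' //= -> ; case: t2 {hg}.
have [|] := @run_embed _ _ _ _ (@fcode _ (f a)) loop_code (@loop_at a) (@loop_lift a)
    (fun q => erefl) (fun q => erefl) t1 t2 _ _ h1.
  by rewrite r1 => y /G [].
rewrite r1 => H1 H2; split; first exact: H1.
rewrite [LHS]H2; congr flatten; apply/eq_in_map => y /G [_ <-] //.
Qed.

End Loop.

(** * Counting paths on a tape *)

(* With [phi] the indicator of acceptance this is [nacc]; with the indicator of
   a given output it determines what a deterministic machine computes. *)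
Fixpoint val_within (M : NTM) (phi : config M -> nat) t (c : config M) : nat :=
  if halted c then phi c else
  if t is t'.+1 then sumn (map (val_within phi t') (succs c)) else 0.

Definition accepting (M : NTM) (c : config M) : bool := c.1.1.1 == @qacc M.

Lemma nacc_val M t (c : config M) : nacc t c = val_within (fun c => nat_of_bool (accepting c)) t c.
Proof.
elim: t c => [|t IH] [[[q l] a] r] /=; rewrite /accepting /=.
  by case: eqP => //=; case: eqP.
case: eqP => //= _; case: eqP => //= _.
by congr sumn; apply: eq_map.
Qed.

Definition shift (d : bool) (p : int) : int := (if d then p + 1 else p - 1)%R.
Definition upd (f : int -> sym) (p : int) (b : sym) : int -> sym :=
  fun x => if x == p then b else f x.

(** Reading both lists with default [None] identifies configurations that differ in trailing blanks,
    and gives the cells absolute addresses. *)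
Definition rep (M : NTM) (c : config M) (q : st M) (p : int) (f : int -> sym) :=
  let: (q', l, a, r) := c in
  [/\ q' = q, a = f p, forall j : nat, nth None l j = f (p - 1 - j%:Z)%R &
      forall j : nat, nth None r j = f (p + 1 + j%:Z)%R].

Lemma rep_move (M : NTM) (c : config M) q p f q' b d :
  rep c q p f -> rep (apply_move c (q', b, d)) q' (shift d p) (upd f p b).
Proof.
case: c => [[[q0 l] a] r] [_ _ hl hr]; rewrite /shift /upd; case: d => /=.
- have H : rep ((q', b :: l, nth None r 0, behead r) : config M) q' (p+1)%R (upd f p b).
    split=> // [|[|j]|j] /=; rewrite /upd.
    + case: eqP => [|_]; first by lia.
      by rewrite hr; congr f; lia.
    + by case: eqP => [//|]; lia.
    + case: eqP => [|_]; first by lia.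
      by rewrite hl; congr f; lia.
    + case: eqP => [|_]; first by lia.
      by rewrite nth_behead hr; congr f; lia.
  by case: r {hr} H.
- have H : rep ((q', behead l, nth None l 0, b :: r) : config M) q' (p-1)%R (upd f p b).
    split=> // [|j|[|j]] /=; rewrite /upd.
    + case: eqP => [|_]; first by lia.
      by rewrite hl; congr f; lia.
    + case: eqP => [|_]; first by lia.
      by rewrite nth_behead hl; congr f; lia.
    + by case: eqP => [//|]; lia.
    + case: eqP => [|_]; first by lia.
      by rewrite hr; congr f; lia.
  by case: l {hl} H.
Qed.

Section evaluates.
Variables (M : NTM) (phi : config M -> nat).

(** A specification to be propagated backwards, from the successors of a configuration to the
    configuration. Quantifying over all larger times allows bounds to be rounded up at every
    step. *)
Definition evaluates q p f t n := forall c : config M, rep c q p f -> forall t', t <= t' ->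
  halts_within t' c /\ val_within phi t' c = n.

Lemma evaluates_mono q p f t t' n : t <= t' -> evaluates q p f t n -> evaluates q p f t' n.
Proof. by move=> tt' H c rc t2 /(leq_trans tt'); apply: H. Qed.

Lemma evaluates_ext q p f g t n : f =1 g -> evaluates q p f t n -> evaluates q p g t n.
Proof.
move=> fg H [[[q' l] a] r] [e1 e2 hl hr]; apply: H; split=> //; first by rewrite fg.
  by move=> j; rewrite fg.
by move=> j; rewrite fg.
Qed.

(** The successors are enumerated from a set, so the list [ms] gives the same sum only when it has
    no repetition. *)
Lemma evaluates_step q p f ms t n_ :
  q != @qacc M -> q != @qrej M -> @delta M q (f p) = [set m in ms] -> uniq ms ->
  {in ms, forall m, evaluates m.1.1 (shift m.2 p) (upd f p m.1.2) t (n_ m)} ->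
  evaluates q p f t.+1 (sumn (map n_ ms)).
Proof.
move=> /negPf qa /negPf qr dl un H [[[q' l] a] r] rc [//|t'] tt'.
have [eq' ea _ _] := rc; subst q' a => /=; rewrite qa qr /= dl.
have pe : perm_eq (enum [set m in ms]) ms.
  by apply: uniq_perm => [|//|m]; rewrite ?enum_uniq // mem_enum inE.
have K m : m \in ms -> halts_within t' (apply_move ((q, l, f p, r) : config M) m) /\
   val_within phi t' (apply_move ((q, l, f p, r) : config M) m) = n_ m.
  move=> mm; apply: (H m mm) => //.
  by have := rep_move m.1.1 m.1.2 m.2 rc; case: m {mm} => [[? ?] ?].
split.
  right=> c' /mapP [m mi ->]; apply: (K m _).1.
  by rewrite -(perm_mem pe).
rewrite -map_comp.
have -> : sumn [seq (val_within phi t' \o apply_move (q, l, f p, r)) i | i <- enum [set m in ms]]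
   = sumn [seq (val_within phi t' \o apply_move (q, l, f p, r)) i | i <- ms].
  by apply: perm_sumn; apply: perm_map.
by congr sumn; apply/eq_in_map => m /K [].
Qed.

Lemma evaluates_step1 q p f m t n :
  q != @qacc M -> q != @qrej M -> @delta M q (f p) = [set x in [:: m]] ->
  evaluates m.1.1 (shift m.2 p) (upd f p m.1.2) t n ->
  evaluates q p f t.+1 n.
Proof.
move=> qa qr dl H; rewrite -(addn0 n).
apply: (@evaluates_step q p f [:: m] t (fun _ => n)) => //.
by move=> m'; rewrite inE => /eqP ->.
Qed.

End evaluates.

(** * Control states of the compiled machine *)

Section MicroState.
Variables (Q : finType) (B : nat).

(* [At z i n] has [n] cells left to walk from the track of stack [i] back to the
   home position, where [z] is executed; [Out] walks away from home to the first
   blank of a track, [Top] steps back from there to the top of the stack, [In]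
   walks back down the track, and [Ch] remembers a nondeterministic choice. *)
Inductive micro_state :=
| MInit of bool
| At of (Q + bool) & 'I_8 & 'I_B.+1
| Out of Q & 'I_B.+1
| Top of Q & 'I_B.+1
| In of (Q + bool) & 'I_8 & 'I_B.+1
| Ch of Q & 'I_B.+1
| Fin of bool & bool.

Definition micro_state_code : Type :=
  (bool + (Q + bool) * 'I_8 * 'I_B.+1 + Q * 'I_B.+1 + Q * 'I_B.+1 +
   (Q + bool) * 'I_8 * 'I_B.+1 + Q * 'I_B.+1 + bool * bool)%type.
HB.instance Definition _ := Finite.on micro_state_code.

Definition micro_state_enc (x : micro_state) : micro_state_code :=
  match x with
  | MInit b => inl (inl (inl (inl (inl (inl b)))))
  | At z i n => inl (inl (inl (inl (inl (inr (z, i, n))))))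
  | Out q n => inl (inl (inl (inl (inr (q, n)))))
  | Top q n => inl (inl (inl (inr (q, n))))
  | In z i n => inl (inl (inr (z, i, n)))
  | Ch q n => inl (inr (q, n))
  | Fin b e => inr (b, e)
  end.
Definition micro_state_dec (x : micro_state_code) : micro_state :=
  match x with
  | inl (inl (inl (inl (inl (inl b))))) => MInit b
  | inl (inl (inl (inl (inl (inr (z, i, n)))))) => At z i n
  | inl (inl (inl (inl (inr (q, n))))) => Out q n
  | inl (inl (inl (inr (q, n)))) => Top q n
  | inl (inl (inr (z, i, n))) => In z i n
  | inl (inr (q, n)) => Ch q n
  | inr (b, e) => Fin b e
  end.
Lemma micro_state_encK : cancel micro_state_enc micro_state_dec. Proof. by case. Qed.
HB.instance Definition _ := Finite.copy micro_state (can_type micro_state_encK).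
End MicroState.
Arguments MInit {Q B}. Arguments Fin {Q B}.

(** * Compiling stack machines *)

(* Stack 0 (input and output) is stored with its bottom at position 0 and grows
   to the right; the other stacks grow to the left, interleaved with period 8.
   The head rests at position -2 between two operations.  On the track of every
   stack the cell before the bottom, [cell i 0], always stays blank, so that a
   walk back along the track knows where to stop. *)
Definition rightward (i : stack) : bool := nat_of_ord i == 0.
Definition stride (i : stack) : nat := if rightward i then 1 else 8.
Definition dpos (i : stack) (n : nat) : int :=
  (if rightward i then n%:Z - 2%:Z else - 2%:Z - n%:Z)%R.
Definition cell (i : stack) (j : nat) : int := dpos i (i.+1 + stride i * j).
Definition tape_holds (s : store) (f : int -> sym) := forall i j,
  f (cell i j) = nth None (None :: map Some (rev (get s i))) j.

Lemma shift_out i n : shift (rightward i) (dpos i n) = dpos i n.+1.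
Proof. by rewrite /shift /dpos; case: (rightward i); lia. Qed.
Lemma shift_in i n : shift (~~ rightward i) (dpos i n.+1) = dpos i n.
Proof. by rewrite /shift /dpos; case: (rightward i) => /=; lia. Qed.

Lemma cell_inj (i i' : stack) j j' : cell i j.+1 = cell i' j' -> i = i' /\ j.+1 = j'.
Proof.
rewrite /cell /dpos /stride /rightward.
case: eqP => hi; case: eqP => hi' h.
- by split; [apply/val_inj; rewrite /= hi hi' | lia].
- by exfalso; lia.
- by exfalso; lia.
- have := ltn_ord i; have := ltn_ord i' => a b.
  have [E1 ->] : nat_of_ord i = i' /\ j.+1 = j' by lia.
  by split=> //; apply: val_inj.
Qed.

Lemma get_put s i w i' : get (put s i w) i' = if i' == i then w else get s i'.
Proof. by rewrite /get /put nth_set_nth /= val_eqE. Qed.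

Lemma rel_push s f i b : tape_holds s f ->
  tape_holds (put s i (b :: get s i)) (upd f (cell i (size (get s i)).+1) (Some b)).
Proof.
move=> H i' j; rewrite /upd get_put; case: eqP => [/esym/cell_inj [-> <-]|ne].
  by rewrite eqxx /= rev_cons map_rcons nth_rcons size_map size_rev ltnn eqxx.
rewrite H; case: eqP => // e; subst i'.
rewrite rev_cons map_rcons; case: j ne => //= j ne.
rewrite nth_rcons size_map size_rev; case: ltngtP => // h.
  by rewrite nth_default // size_map size_rev ltnW.
by rewrite h in ne.
Qed.

Lemma rel_pop s f i b w : tape_holds s f -> get s i = b :: w ->
  tape_holds (put s i w) (upd f (cell i (size (get s i))) None).
Proof.
move=> H e i' j; rewrite /upd get_put e; case: eqP => [/esym/cell_inj [-> <-]|ne].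
  by rewrite eqxx /= nth_default // size_map size_rev.
rewrite H; case: eqP => // e'; subst i'.
rewrite e rev_cons map_rcons; case: j ne => //= j ne.
rewrite nth_rcons size_map size_rev; case: ltngtP => // h.
  by rewrite nth_default // size_map size_rev ltnW.
by rewrite h in ne.
Qed.

Section Compile.
Variable F : frag bool.
Local Notation Q := (fq F).

Definition stack_of (q : Q) : stack :=
  match fcode q with Push i _ _ | Pop i _ => i | Choose _ => ord0 end.
Definition nchoices (q : Q) : nat :=
  if fcode q is Choose zs then size zs else 0.
(** The longest counted walk is [i + stride i], at most 7 + 8 = 15; the other summand makes room for
    the index of a choice. *)
Definition counter_max : nat := 15 + \max_q nchoices q.
Local Notation state := (micro_state Q counter_max).
Local Notation cn n := (inord n : 'I_counter_max.+1).

(** Every move displaces the head, so a choice is a step to the right, followed by a step back in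
    state [Ch]. The index stored in [Ch] separates equal entries of a choice list, which would
    otherwise be a single element of [delta]. *)
Definition micro_moves (x : state) (a : sym) : seq (state * sym * bool) :=
  match x with
  | MInit false => [:: (MInit true, a, false)]
  | MInit true => [:: (At (inl (fentry F)) ord0 ord0, a, false)]
  | At z i n =>
    if nat_of_ord n is n'.+1 then [:: (At z i (cn n'), a, ~~ rightward i)] else
    match z with
    | inr b => [:: (Fin b false, a, true)]
    | inl q =>
      match fcode q with
      | Push i _ _ | Pop i _ => [:: (Out q (cn (i + stride i)), a, rightward i)]
      | Choose zs => [seq (Ch q (cn j), a, true) | j <- iota 0 (size zs)]
      end
    end
  | Out q n =>
    let i := stack_of q in
    if nat_of_ord n is n'.+1 then [:: (Out q (cn n'), a, rightward i)] else
    if a is Some _ then [:: (Out q (cn (stride i).-1), a, rightward i)] else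
    match fcode q with
    | Push i b z => [:: (In z i (cn (stride i).-1), Some b, ~~ rightward i)]
    | Pop i _ => [:: (Top q (cn (stride i).-1), None, ~~ rightward i)]
    | Choose _ => [::]
    end
  | Top q n =>
    if nat_of_ord n is n'.+1 then [:: (Top q (cn n'), a, ~~ rightward (stack_of q))] else
    if fcode q is Pop i k then
      [:: (if a is Some _ then In (k a) i (cn (stride i).-1) else At (k a) i (cn i),
           None, ~~ rightward i)]
    else [::]
  | In z i n =>
    if nat_of_ord n is n'.+1 then [:: (In z i (cn n'), a, ~~ rightward i)] else
    [:: (if a is Some _ then In z i (cn (stride i).-1) else At z i (cn i),
         a, ~~ rightward i)]
  | Ch q n =>
    if fcode q is Choose zs then
      [:: (At (nth (inl q) zs n) ord0 ord0, a, false)] else [::]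
  | Fin b false => [:: (Fin b true, a, true)]
  | Fin b true => [::]
  end.

Definition compile : NTM :=
  {| st := state; start := MInit false; qacc := Fin true true;
     qrej := Fin false true;
     delta := fun x a => [set m in micro_moves x a] |}.

Variable phi : config compile -> nat.
Local Notation R := (@evaluates compile phi).

Definition active (x : state) := if x is Fin _ true then false else true.

Lemma micro_step (x : state) p f m t n : active x -> micro_moves x (f p) = [:: m] ->
  R m.1.1 (shift m.2 p) (upd f p m.1.2) t n -> R x p f t.+1 n.
Proof.
move=> ax nx H; apply: (@evaluates_step1 compile phi x p f m t n) H.
- by apply/eqP => e; rewrite e in ax.
- by apply/eqP => e; rewrite e in ax.
- by rewrite /= nx.
Qed.

Lemma upd_id f p : upd f p (f p) =1 f.
Proof. by move=> x; rewrite /upd; case: eqP => // ->. Qed.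

Lemma micro_step_id (x : state) p f x' d t n : active x -> micro_moves x (f p) = [:: (x', f p, d)] ->
  R x' (shift d p) f t n -> R x p f t.+1 n.
Proof.
move=> ax nx H; apply: (micro_step ax nx); apply: evaluates_ext H => y; by rewrite upd_id.
Qed.

Lemma walk (w : 'I_counter_max.+1 -> state) d p f t v n : n <= counter_max ->
  (forall x : 'I_counter_max.+1, active (w x)) ->
  (forall (x : 'I_counter_max.+1) a k, nat_of_ord x = k.+1 -> micro_moves (w x) a = [:: (w (cn k), a, d)]) ->
  R (w ord0) (iter n (shift d) p) f t v -> R (w (cn n)) p f (n + t) v.
Proof.
move=> nc aw nw; elim: n p nc => [|n IH] p nc H.
  by have -> : cn 0 = ord0 by apply: val_inj; rewrite /= inordK.
rewrite addSn; apply: (@micro_step_id _ _ _ (w (cn n)) d) => //.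
  by apply: nw; rewrite inordK.
by apply: IH; [exact: ltnW|rewrite -iterSr].
Qed.

Lemma iter_out i n p : iter n (shift (rightward i)) (dpos i p) = dpos i (p + n).
Proof. by elim: n => [|n IH]; rewrite ?addn0 //= IH shift_out addnS. Qed.
Lemma iter_in i n p : iter n (shift (~~ rightward i)) (dpos i (p + n)) = dpos i p.
Proof.
elim: n p => [|n IH] p; rewrite ?addn0 //= addnS -addSn IH.
exact: shift_in.
Qed.

Lemma stride_gt0 i : 0 < stride i. Proof. by rewrite /stride; case: ifP. Qed.
Lemma stride_le i : stride i <= 8. Proof. by rewrite /stride; case: ifP. Qed.
Lemma bound_ctr (i : stack) : i + stride i <= counter_max.
Proof. by have := ltn_ord i; have := stride_le i; rewrite /counter_max; lia. Qed.

Lemma walk_out q n p f t v : n <= counter_max ->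
  R (Out q ord0) (dpos (stack_of q) (p + n)) f t v ->
  R (Out q (cn n)) (dpos (stack_of q) p) f (n + t) v.
Proof.
move=> nc H; apply: (@walk (Out q) (rightward (stack_of q))) => //.
  by move=> x a k /= ->.
by rewrite iter_out.
Qed.

Lemma walk_in (w : 'I_counter_max.+1 -> state) i n p f t v : n <= counter_max ->
  (forall x : 'I_counter_max.+1, active (w x)) ->
  (forall (x : 'I_counter_max.+1) a k, nat_of_ord x = k.+1 ->
     micro_moves (w x) a = [:: (w (cn k), a, ~~ rightward i)]) ->
  R (w ord0) (dpos i p) f t v -> R (w (cn n)) (dpos i (p + n)) f (n + t) v.
Proof.
by move=> nc aw nw H; apply: (@walk w (~~ rightward i)) => //; rewrite iter_in.
Qed.

Lemma cellS i j : cell i j.+1 = dpos i ((i.+1 + stride i * j) + (stride i).-1).+1.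
Proof. by rewrite /cell mulnS; have := stride_gt0 i => h; congr dpos; lia. Qed.

Lemma stack_cell s f i j : tape_holds s f -> 0 < j <= size (get s i) -> exists b, f (cell i j) = Some b.
Proof.
move=> H; rewrite H; case: j => //= j js.
by exists (nth false (rev (get s i)) j); rewrite (nth_map false) // size_rev.
Qed.

Lemma stack_end s f i : tape_holds s f -> f (cell i (size (get s i)).+1) = None.
Proof. by move=> H; rewrite H /= nth_default // size_map size_rev. Qed.

Lemma stride_ctr i : (stride i).-1 <= counter_max.
Proof. have := bound_ctr i; lia. Qed.
Lemma stack_ctr (i : stack) : i <= counter_max.
Proof. have := bound_ctr i; lia. Qed.

Lemma to_home (z : Q + bool) i f t v :
  R (At z i ord0) (dpos i 0) f t v ->
  R (At z i (cn i)) (dpos i i) f (i + t) v.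
Proof.
move=> H; have := @walk_in (At z i) i i 0 f t v (stack_ctr i).
by rewrite add0n; apply => // x a k /= ->.
Qed.

Lemma scan_home s f z i j t v : tape_holds s f -> j <= size (get s i) ->
  R (At z i ord0) (dpos i 0) f t v ->
  R (In z i ord0) (cell i j) f ((stride i * j + i.+1) + t) v.
Proof.
move=> H; elim: j => [|j IH] js Hh.
  rewrite muln0 add0n /cell muln0 addn0 addSn.
  apply: (@micro_step_id _ _ _ (At z i (cn i)) (~~ rightward i)) => //=.
    by have := H i 0; rewrite /cell muln0 addn0 => ->.
  by rewrite shift_in; apply: to_home.
have [b fb] := stack_cell H (js : 0 < j.+1 <= _).
have -> : stride i * j.+1 + i.+1 + t = ((stride i).-1 + (stride i * j + i.+1 + t)).+1.
  by rewrite mulnS; have := stride_gt0 i; lia.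
apply: (@micro_step_id _ _ _ (In z i (cn (stride i).-1)) (~~ rightward i)) => //=.
  by rewrite fb.
rewrite cellS shift_in; apply: walk_in => //; first exact: stride_ctr.
  by move=> x a k /= ->.
by apply: IH => //; apply: ltnW.
Qed.

Lemma scan_end s f q k t v : tape_holds s f -> k <= size (get s (stack_of q)) ->
  R (Out q ord0) (cell (stack_of q) (size (get s (stack_of q))).+1) f t v ->
  R (Out q ord0) (cell (stack_of q) (size (get s (stack_of q)) - k).+1) f
    (stride (stack_of q) * k + t) v.
Proof.
set i := stack_of q => H; elim: k => [|k IH] ks He; first by rewrite subn0 muln0.
have js : 0 < (size (get s i) - k.+1).+1 <= size (get s i) by lia.
have [b fb] := stack_cell H js.
have -> : stride i * k.+1 + t = ((stride i).-1 + (stride i * k + t)).+1.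
  by rewrite mulnS; have := stride_gt0 i; lia.
apply: (@micro_step_id _ _ _ (Out q (cn (stride i).-1)) (rightward i)) => //=.
  by rewrite fb.
rewrite /cell shift_out; apply: walk_out; first exact: stride_ctr.
have := IH (ltnW ks) He.
have -> : (size (get s i) - k).+1 = (size (get s i) - k.+1).+2 by lia.
rewrite -/i /cell.
suff -> : i.+1 + stride i * (size (get s i) - k.+1).+2 =
  (i.+1 + stride i * (size (get s i) - k.+1).+1).+1 + (stride i).-1 by [].
by rewrite [in LHS]mulnS; have := stride_gt0 i; lia.
Qed.

Lemma go_end s f q i' t v : tape_holds s f ->
  (if fcode q is Choose _ then false else true) ->
  let i := stack_of q in
  R (Out q ord0) (cell i (size (get s i)).+1) f t v ->
  R (At (inl q) i' ord0) (dpos i 0) f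
    ((i + stride i).+1 + (stride i * size (get s i) + t)) v.
Proof.
move=> H hq i He; rewrite addSn.
apply: (@micro_step_id _ _ _ (Out q (cn (i + stride i))) (rightward i)) => //=.
  by rewrite /i /stack_of; case: (fcode q) hq.
rewrite shift_out; apply: walk_out; first exact: bound_ctr.
have := scan_end H (leqnn _) He; rewrite subnn /cell.
by rewrite muln1 -/i add1n -addSn.
Qed.

Definition home : int := (- 2%:Z)%R.
Lemma dpos0 i : dpos i 0 = home.
Proof. by rewrite /dpos /home; case: (rightward i); lia. Qed.

(** The head walks out along the track and back, at most eight cells per stored bit each way; hence
    the factor 16. *)
Lemma micro_push s f q i b z i' m t v : fcode q = Push i b z -> tape_holds s f ->
  size (get s i) <= m ->
  (forall f', tape_holds (put s i (b :: get s i)) f' -> R (At z i ord0) home f' t v) ->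
  R (At (inl q) i' ord0) home f (16 * (m + 4) + t) v.
Proof.
move=> cq H sm Hn; have ei : stack_of q = i by rewrite /stack_of cq.
rewrite -(dpos0 i).
apply: (@evaluates_mono _ _ _ _ _ ((i + stride i).+1 + (stride i * size (get s i) +
   ((stride i).-1 + ((stride i * size (get s i) + i.+1) + t)).+1))).
  have := stride_le i; have := stride_gt0 i; have := ltn_ord i.
  suff: stride i * size (get s i) <= 8 * m by lia.
  by apply: leq_mul => //; apply: stride_le.
have := @go_end s f q i' _ v H; rewrite cq ei; apply=> //.
apply: (@micro_step _ _ _ (In z i (cn (stride i).-1), Some b, ~~ rightward i)) => //=.
  by rewrite (stack_end _ H) cq.
rewrite {1}cellS shift_in; apply: walk_in => //; first exact: stride_ctr.
  by move=> x a k /= ->.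
have H' := rel_push i b H.
apply: (scan_home H'); first by rewrite get_put eqxx /=.
by rewrite dpos0; apply: Hn.
Qed.

Lemma micro_pop s f q i k i' m t v : fcode q = Pop i k -> tape_holds s f ->
  size (get s i) <= m ->
  (forall f', tape_holds (put s i (behead (get s i))) f' ->
     R (At (k (ohead (get s i))) i ord0) home f' t v) ->
  R (At (inl q) i' ord0) home f (16 * (m + 4) + t) v.
Proof.
move=> cq H sm Hn; have ei : stack_of q = i by rewrite /stack_of cq.
rewrite -(dpos0 i).
apply: (@evaluates_mono _ _ _ _ _ ((i + stride i).+1 + (stride i * size (get s i) +
   ((stride i).-1 + (stride i * size (get s i) + i.+1 + t)).+1))).
  have := stride_le i; have := stride_gt0 i; have := ltn_ord i.
  suff: stride i * size (get s i) <= 8 * m by lia.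
  by apply: leq_mul => //; apply: stride_le.
have := @go_end s f q i' _ v H; rewrite cq ei; apply=> //.
have fe := stack_end i H.
apply: (@micro_step_id _ _ _ (Top q (cn (stride i).-1)) (~~ rightward i)) => //=.
  by rewrite fe cq.
rewrite {1}cellS shift_in; apply: walk_in => //; first exact: stride_ctr.
  by move=> x a k' /= ->; rewrite ei.
case e : (get s i) => [|b w] in Hn *.
  have f0 : f (cell i 0) = None by rewrite H.
  rewrite muln0 add0n addSn.
  apply: (@micro_step_id _ _ _ (At (k None) i (cn i)) (~~ rightward i)) => //=.
    by have := f0; rewrite /cell muln0 => ->; rewrite cq.
  rewrite addn0 shift_in; apply: to_home; rewrite dpos0; apply: Hn.
  by move=> i2 j; rewrite get_put H; case: eqP => // ->; rewrite e.
have fb : f (cell i (size w).+1) = Some b.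
  by rewrite H e /= rev_cons map_rcons nth_rcons size_map size_rev ltnn eqxx.
have -> : stride i * size (b :: w) + i.+1 + t =
   ((stride i).-1 + (stride i * size w + i.+1 + t)).+1.
  by rewrite /= mulnS; have := stride_gt0 i; lia.
apply: (@micro_step _ _ _ (In (k (Some b)) i (cn (stride i).-1), None, ~~ rightward i)) => //=.
  by rewrite -/(cell i (size w).+1) fb cq.
rewrite -/(cell i (size w).+1) {1}cellS shift_in; apply: walk_in => //; first exact: stride_ctr.
  by move=> x a k' /= ->.
have H' := rel_pop H e; rewrite e in H'.
apply: (scan_home H'); first by rewrite get_put eqxx.
by rewrite dpos0; apply: Hn.
Qed.

Lemma micro_choose f q zs i' t (n_ : Q + bool -> nat) : fcode q = Choose zs ->
  {in zs, forall z, forall i, R (At z i ord0) home f t (n_ z)} ->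
  R (At (inl q) i' ord0) home f (2 + t) (sumn (map n_ zs)).
Proof.
move=> cq Hn.
have zc : size zs <= counter_max.
  rewrite /counter_max; apply: leq_trans (leq_addl _ _).
  by have := @leq_bigmax _ nchoices q; rewrite {1}/nchoices cq.
(* The choices are reindexed by their positions, which turns a list with possible repetitions into a
   list of distinct moves. *)
have -> : map n_ zs = map (fun m : state * sym * bool =>
    if m.1.1 is Ch _ n then n_ (nth (inl q) zs n) else 0)
    [seq (Ch q (cn j), f home, true) | j <- iota 0 (size zs)].
  rewrite -map_comp /= -[zs in LHS](mkseq_nth (inl q)) -map_comp.
  apply/eq_in_map => j; rewrite mem_iota => /andP [_ jz] /=.
  by rewrite inordK //; lia.
apply: (@evaluates_step compile phi) => //=.
- by rewrite cq.
- rewrite map_inj_in_uniq ?iota_uniq // => j j'; rewrite !mem_iota add0n.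
  move=> /andP [_ a] /andP [_ b] [] /(congr1 val).
  by rewrite /= !inordK // ltnS; apply: leq_trans zc; apply: ltnW.
- move=> _ /mapP [j ji ->] /=.
  move: ji; rewrite mem_iota => /andP [_ jz].
  apply: (@evaluates_ext _ _ _ _ f) => [x|]; first by rewrite upd_id.
  have jj : nat_of_ord (cn j) = j.
    by rewrite inordK // ltnS; apply: leq_trans zc; apply: ltnW.
  apply: (@micro_step_id _ _ _ (At (nth (inl q) zs (cn j)) ord0 ord0) false) => //=; first by rewrite cq.
  rewrite (_ : (_ + 1 - 1)%R = home); last by rewrite /home; lia.
  by apply: Hn; rewrite jj mem_nth.
Qed.

(** Within [t] steps no stack grows beyond [m + t], so each step costs at most [16 * (m + t + 4)]
    moves. The weight [w] is left open so that the same statement serves for counting acceptance and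
    for testing an output. *)
Lemma compile_run t z s f m w tau : halts (@fcode _ F) t z s -> tape_holds s f ->
  (forall i, size (get s i) <= m) ->
  {in run (@fcode _ F) t z s, forall y f' i, tape_holds y.2 f' ->
     R (At (inr y.1) i ord0) home f' tau (w y)} ->
  forall i, R (At z i ord0) home f (t * (16 * (m + t + 4)) + tau)
    (sumn (map w (run (@fcode _ F) t z s))).
Proof.
elim: t z s f m => [|t IH] [q|b] s f m //=.
- by move=> _ rf _ H i; rewrite mul0n add0n addn0; apply: (H (b, s)); rewrite ?inE.
- case cq : (fcode q) => [j b z|j k|zs] h rf sm H i.
  + apply: (@evaluates_mono _ _ _ _ _ (16 * (m + 4) + (t * (16 * (m.+1 + t + 4)) + tau))).
      by nia.
    apply: (micro_push cq rf (sm j)) => f' rf'.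
    apply: IH => // i'; rewrite get_put; case: ifP => _ /=; first by rewrite ltnS.
    exact: leqW.
  + apply: (@evaluates_mono _ _ _ _ _ (16 * (m + 4) + (t * (16 * (m + t + 4)) + tau))).
      by nia.
    apply: (micro_pop cq rf (sm j)) => f' rf'.
    apply: IH => // i'; rewrite get_put; case: ifP => _ //.
    by rewrite size_behead; apply: leq_trans (sm j); apply: leq_pred.
  + have -> : sumn [seq w i | i <- flatten [seq run (@fcode _ F) t z' s | z' <- zs]] =
      sumn [seq sumn (map w (run (@fcode _ F) t z' s)) | z' <- zs].
      elim: (zs) => //= z zs' IHz; by rewrite map_cat sumn_cat IHz.
    apply: (@evaluates_mono _ _ _ _ _ (2 + (t * (16 * (m + t + 4)) + tau))); first by nia.
    apply: (@micro_choose f q zs i _ (fun z => sumn [seq w i | i <- run (@fcode _ F) t z s])) => // z zz i'.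
    apply: IH => //; first by move/allP: h; apply.
    move=> y yr; apply: H; apply/flattenP; exists (run (@fcode _ F) t z s) => //.
    by apply/mapP; exists z.
- move=> _ rf _ H i; rewrite addn0; apply: evaluates_mono (H (b, s) _ _ i rf); rewrite ?inE //.
  exact: leq_addl.
Qed.

(** The top of stack 0 is its rightmost cell, so the input appears on it in reverse. *)
Definition start_store (x : word) : store := [:: rev x; [::]; [::]; [::]; [::]; [::]; [::]; [::]].

Definition init_tape (x : word) (p : int) : sym :=
  match p with Posz n => nth None (map Some x) n | Negz _ => None end.

Lemma rep_init x : @rep compile (init compile x) (MInit false) 0%R (init_tape x).
Proof.
have e1 (j : nat) : (0 - 1 - j%:Z)%R = Negz j by lia.
have e2 (j : nat) : (0 + 1 + j%:Z)%R = Posz j.+1 by lia.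
by case: x => [|b x]; split=> // j; rewrite ?e1 ?e2 /= ?nth_nil.
Qed.

Lemma rel_init x : tape_holds (start_store x) (init_tape x).
Proof.
move=> i j; rewrite /cell /dpos /stride; case hi: (rightward i).
  have -> : i = ord0 by apply: val_inj; apply/eqP.
  rewrite /get /start_store [nth [::] _ (nat_of_ord ord0)]/= revK.
  case: j => [//|j]; have -> : ((1 + 1 * j.+1)%:Z - 2%:Z)%R = Posz j by lia.
  by [].
have -> : (- 2%:Z - (i.+1 + 8 * j)%:Z)%R = Negz (i.+1 + 8 * j).+1 by lia.
move/negbT: hi; rewrite /rightward /get.
by case: i => [[|[|[|[|[|[|[|[|]]]]]]]] hi] //=; case: j => [|[]].
Qed.

Lemma compile_evaluates x t o w : exec F (start_store x) t o ->
  {in o, forall y f (c : config compile), tape_holds y.2 f ->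
     @rep compile c (Fin y.1 true) 0%R f -> phi c = w y} ->
  R (MInit false) 0%R (init_tape x) (2 + (t * (16 * (size x + t + 4)) + 2)) (sumn (map w o)).
Proof.
move=> [h <-] H.
(* Two moves bring the head from 0 to [home]; two moves at the end bring it back to 0, where the
   output is read. *)
apply: (@micro_step_id _ _ _ (MInit true) false) => //.
apply: (@micro_step_id _ _ _ (At (inl (fentry F)) ord0 ord0) false) => //.
have -> : shift false (shift false 0%R) = home by [].
apply: compile_run h (rel_init x) _ _ _.
  move=> i; rewrite /get /start_store.
  case: i => [[|[|[|[|[|[|[|[|]]]]]]]] hi] //=; by rewrite size_rev.
move=> y yr f i rf.
apply: (@micro_step_id _ _ _ (Fin y.1 false) true) => //.
apply: (@micro_step_id _ _ _ (Fin y.1 true) true) => //.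
have -> : shift true (shift true home) = 0%R by [].
move=> c rc t' _; have P := H _ yr _ c rf rc.
case: c rc P => [[[q l] a] r] [] -> _ _ _ P.
case: t' => [|t'] /=; rewrite P; case: (y.1); rewrite !eqxx ?orbT; split=> //; by left.
Qed.

End Compile.

(** * Composition rules and polynomial bounds *)

Notation IO := (@Ordinal 8 0 isT).
Notation TL := (@Ordinal 8 1 isT).
Notation TR := (@Ordinal 8 2 isT).
Notation XS := (@Ordinal 8 3 isT).
Notation WS := (@Ordinal 8 4 isT).
Notation ZS := (@Ordinal 8 5 isT).
Notation AS := (@Ordinal 8 6 isT).
Notation YS := (@Ordinal 8 7 isT).

Lemma bits_until_blank_map (l : seq sym) (w : word) :
  (forall j, nth None l j = nth None (map Some w) j) -> bits_until_blank l = w.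
Proof.
elim: l w => [|a l IH] [|b w] H //=; first by have := H 0.
  by have := H 0; rewrite /= => ->.
have := H 0; rewrite /= => ->; congr cons; apply: IH => j; exact: (H j.+1).
Qed.

Definition compile_time (n t : nat) := 4 + t * (16 * (n + t + 4)).

Lemma compile_cnt F x t t' n : cnt F (start_store x) t n -> compile_time (size x) t <= t' ->
  halts_within t' (init (compile F) x) /\ nacc t' (init (compile F) x) = n.
Proof.
move=> [o ex <-] tt'; rewrite nacc_val.
pose phi (c : config (compile F)) := nat_of_bool (accepting c).
pose w (y : bool * store) := nat_of_bool y.1.
have H : {in o, forall y f (c : config (compile F)), tape_holds y.2 f ->
    rep c (Fin y.1 true : st (compile F)) 0%R f -> phi c = w y}.
  move=> [b s] _ f [[[q l] a] r] _ [-> _ _ _].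
  by rewrite /phi /accepting /w /=; case: b.
have tt2 : 2 + (t * (16 * (size x + t + 4)) + 2) <= t'.
  by apply: leq_trans tt'; rewrite /compile_time; lia.
have [h v] := compile_evaluates ex H (rep_init F x) tt2.
split=> //; rewrite [LHS]v.
by elim: (o) => //= -[b s] l -> /=.
Qed.

(** There is only one path, so a total weight of 1 for the indicator of output [w] says that this
    path halts with that output. Thus the counting semantics also covers computed functions. *)
Lemma det_val (M : NTM) w t (c : config M) : deterministic M ->
  val_within (fun c => nat_of_bool (output c == w)) t c = 1 -> output (drun t c) = w.
Proof.
move=> dM; elim: t c => [|t IH] c /=; first by case: ifP => // _; case: eqP.
case: ifP => // _; first by case: eqP.
have : size (succs c) <= 1.
  by case: c => [[[q l] a] r] /=; rewrite size_map -cardE; apply: dM.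
by case: (succs c) => [|c' [|]] //= _; rewrite addn0; apply: IH.
Qed.

(** One option is allowed because [ret] is itself a choice with a single entry. *)
Definition det_frag (X : finType) (f : frag X) :=
  forall q : fq f, if fcode q is Choose zs then size zs <= 1 else true.

Lemma compile_det F : det_frag F -> deterministic (compile F).
Proof.
move=> dF x a /=; rewrite cardsE; apply: leq_trans (card_size _) _.
case: x => [[]|z i [[|n] hn]|q [[|n] hn]|q [[|n] hn]|z i [[|n] hn]|q n|b []] //=.
- by case: z => // q; have := dF q; case: (fcode q) => // zs; rewrite size_map size_iota.
- by case: a => //; case: (fcode q).
- by case: (fcode q).
- by case: (fcode q).
Qed.

Lemma compile_output F x t t' b s : det_frag F ->
  exec F (start_store x) t [:: (b, s)] -> compile_time (size x) t <= t' ->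
  halts_within t' (init (compile F) x) /\
  output (drun t' (init (compile F) x)) = rev (get s IO).
Proof.
move=> dF ex tt'.
pose phi (c : config (compile F)) := nat_of_bool (output c == rev (get s IO)).
have H : {in [:: (b, s)], forall y f (c : config (compile F)), tape_holds y.2 f ->
    rep c (Fin y.1 true : st (compile F)) 0%R f -> phi c = 1}.
  move=> y; rewrite inE => /eqP -> f [[[q l] a] r] rl [_ ea _ er].
  rewrite /phi; suff -> : output ((q, l, a, r) : config (compile F)) = rev (get s IO) by rewrite eqxx.
  apply: bits_until_blank_map => j; have := rl IO j.+1.
  rewrite /cell /dpos /stride /= => <-; case: j => [|j]; first by rewrite /= ea.
  by rewrite -[nth _ _ _ in LHS]/(nth None r j) er; congr f; lia.
have tt2 : 2 + (t * (16 * (size x + t + 4)) + 2) <= t'.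
  by apply: leq_trans tt'; rewrite /compile_time; lia.
have [h v] := compile_evaluates ex H (rep_init F x) tt2.
by split=> //; apply: det_val v; apply: compile_det.
Qed.

Lemma exec_mono X (f : frag X) s t t' o : t <= t' -> exec f s t o -> exec f s t' o.
Proof. by move=> tt' [h r]; have [h' r'] := run_mono tt' h; split; rewrite ?r'. Qed.

Lemma cnt_mono f s t t' n : t <= t' -> cnt f s t n -> cnt f s t' n.
Proof. by move=> tt' [o ex co]; exists o => //; apply: exec_mono ex. Qed.

Lemma exec_push i b s : exec (push i b) s 1 [:: (tt, put s i (b :: get s i))].
Proof. by []. Qed.

Lemma exec_pop i s : exec (pop i) s 1 [:: (ohead (get s i), put s i (behead (get s i)))].
Proof. by []. Qed.

Lemma exec_guess (X : finType) (xs : seq X) s : exec (guess xs) s 1 [seq (x, s) | x <- xs].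
Proof.
split; first by rewrite /= all_map; apply/allP.
by rewrite /=; elim: xs => //= x xs ->.
Qed.

Lemma exec_ret (X : finType) (x : X) s : exec (ret x) s 1 [:: (x, s)].
Proof. exact: exec_guess. Qed.

Lemma exec_seq (X Y : finType) (f : frag X) (g : X -> frag Y) s t1 t2 x s' o :
  exec f s t1 [:: (x, s')] -> exec (g x) s' t2 o -> exec (bind f g) s (t1 + t2) o.
Proof.
move=> ef eg; have := @exec_bind _ _ f g s t1 t2 _ (fun _ => o) ef.
by rewrite /= cats0; apply=> y; rewrite inE => /eqP ->.
Qed.

Lemma exec_guess_bind (X Y : finType) (xs : seq X) (g : X -> frag Y) s t h :
  {in xs, forall x, exec (g x) s t (h x)} ->
  exec (bind (guess xs) g) s t.+1 (flatten (map h xs)).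
Proof.
move=> H; have := @exec_bind _ _ (guess xs) g s 1 t _ (fun y => h y.1) (exec_guess xs s).
rewrite -map_comp add1n; apply=> y /mapP [x xx ->]; exact: H.
Qed.

Lemma cnt_seq (X : finType) (f : frag X) (g : X -> frag bool) s t1 t2 x s' n :
  exec f s t1 [:: (x, s')] -> cnt (g x) s' t2 n -> cnt (bind f g) s (t1 + t2) n.
Proof. by move=> ef [o eg co]; exists o => //; apply: exec_seq eg. Qed.

Lemma count_flatten_map (A B : eqType) (a : pred B) (h : A -> seq B) (n : A -> nat) (l : seq A) :
  {in l, forall y, count a (h y) = n y} -> count a (flatten (map h l)) = sumn (map n l).
Proof.
elim: l => //= y l IH H; rewrite count_cat H ?mem_head // IH // => z zl.
by apply: H; rewrite inE zl orbT.
Qed.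

Lemma cnt_bind (X : finType) (I : eqType) (f : frag X) (g : X -> frag bool) s t1 t2
    (l : seq I) (z : I -> X) (s' : I -> store) n :
  exec f s t1 [seq (z i, s' i) | i <- l] ->
  {in l, forall i, cnt (g (z i)) (s' i) t2 (n i)} ->
  cnt (bind f g) s (t1 + t2) (sumn (map n l)).
Proof.
move=> ef eg.
pose h (y : X * store) := run (@fcode _ (g y.1)) t2 (inl (fentry (g y.1))) y.2.
exists (flatten (map h [seq (z i, s' i) | i <- l])).
  by apply: exec_bind => // y /mapP [i /eg [o' [h' _] _] ->]; split.
by rewrite -map_comp; apply: count_flatten_map => i /eg [o' [_ <-] ].
Qed.

Lemma cnt_loop (A : finType) (I : eqType) (f : A -> frag (A + bool)%type) a s t1 t2
    (l : seq I) (z : I -> (A + bool)%type) (s' : I -> store) n :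
  exec (f a) s t1 [seq (z i, s' i) | i <- l] ->
  {in l, forall i, match z i with
     | inl a' => cnt (loop f a') (s' i) t2 (n i)
     | inr b => n i = nat_of_bool b end} ->
  cnt (loop f a) s (t1 + t2) (sumn (map n l)).
Proof.
move=> ef eg.
pose h (y : (A + bool) * store) := match y.1 with
  | inl a' => run (@fcode _ (loop f a')) t2 (inl (fentry (loop f a'))) y.2
  | inr b => [:: (b, y.2)] end.
exists (flatten (map h [seq (z i, s' i) | i <- l])).
  apply: exec_loop ef _ => y /mapP [i il ->]; have := eg i il; rewrite /h /=.
  by case: (z i) => // a'; case=> o' [h' _] _; split.
rewrite -map_comp; apply: count_flatten_map => i /eg; rewrite /h /=.
case: (z i) => [a'|b]; first by case=> o' [_ <-].
by move=> -> /=; rewrite addn0.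
Qed.

Lemma exec_loop_next (A Y : finType) (f : A -> frag (A + Y)%type) a a' s s' t1 t2 o :
  exec (f a) s t1 [:: (inl a', s')] -> exec (loop f a') s' t2 o ->
  exec (loop f a) s (t1 + t2) o.
Proof.
move=> ef eg; have := @exec_loop _ _ f a s t1 t2 _ (fun _ => o) ef.
by rewrite /= cats0; apply=> y; rewrite inE => /eqP ->.
Qed.

Lemma cnt_loop_next (A : finType) (f : A -> frag (A + bool)%type) a a' s s' t1 t2 n :
  exec (f a) s t1 [:: (inl a', s')] -> cnt (loop f a') s' t2 n ->
  cnt (loop f a) s (t1 + t2) n.
Proof. by move=> ef [o eg co]; exists o => //; apply: exec_loop_next eg. Qed.

Lemma exec_loop_exit (A Y : finType) (f : A -> frag (A + Y)%type) a y s s' t :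
  exec (f a) s t [:: (inr y, s')] -> exec (loop f a) s t [:: (y, s')].
Proof.
move=> ef; have := @exec_loop _ _ f a s t 0 _ (fun _ => [:: (y, s')]) ef.
by rewrite /= addn0; apply=> z; rewrite inE => /eqP ->.
Qed.

Lemma cnt_loop_exit (A : finType) (f : A -> frag (A + bool)%type) a b s s' t :
  exec (f a) s t [:: (inr b, s')] -> cnt (loop f a) s t b.
Proof. by move=> /exec_loop_exit ef; exists [:: (b, s')] => //=; rewrite addn0. Qed.

Lemma det_pop i : det_frag (pop i). Proof. by []. Qed.
Lemma det_ret (X : finType) (x : X) : det_frag (ret x). Proof. by []. Qed.

Lemma det_bind (X Y : finType) (f : frag X) (g : X -> frag Y) :
  det_frag f -> (forall x, det_frag (g x)) -> det_frag (bind f g).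
Proof.
move=> df dg [q|[x q]] /=.
  by have := df q; case: (fcode q) => //= zs; rewrite size_map.
by have := dg x q; case: (fcode q) => //= zs; rewrite size_map.
Qed.

Lemma det_loop (A Y : finType) (f : A -> frag (A + Y)%type) a :
  (forall a, det_frag (f a)) -> det_frag (loop f a).
Proof.
move=> df [a' q] /=.
by have := df a' q; case: (fcode q) => //= zs; rewrite size_map.
Qed.

(** With the base [n.+1], which is never zero, powers are monotone in the exponent and a constant is
    absorbed by the leading factor; the closure properties then become computations with
    exponents. *)
Lemma poly_boundP T : poly_bound T <-> exists C k, forall n, T n <= C * n.+1 ^ k.
Proof.
split=> -[c [k H]].
  exists (2 * c), k => n; apply: leq_trans (H n) _.
  have h1 : 0 < n.+1 ^ k by rewrite expn_gt0.
  have h2 : n ^ k <= n.+1 ^ k by case: (k) => // k'; rewrite leq_exp2r.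
  by nia.
exists (c * 2 ^ k), k => n; apply: leq_trans (H n) _.
suff: n.+1 ^ k <= 2 ^ k * n ^ k + 2 ^ k by nia.
case: n {H} => [|n]; first by rewrite exp1n; have := expn_gt0 2 k; lia.
rewrite -expnMn; apply: leq_trans (leq_addr _ _).
by case: (k) => // k'; rewrite leq_exp2r //; lia.
Qed.

Lemma poly_const c : poly_bound (fun _ => c).
Proof. by exists c, 0 => n; rewrite expn0; lia. Qed.

Lemma poly_id : poly_bound id.
Proof. by exists 1, 1 => n; rewrite expn1; lia. Qed.

Lemma poly_le T T' : (forall n, T n <= T' n) -> poly_bound T' -> poly_bound T.
Proof. by move=> h [c [k H]]; exists c, k => n; apply: leq_trans (H n). Qed.

Lemma poly_add T1 T2 : poly_bound T1 -> poly_bound T2 -> poly_bound (fun n => T1 n + T2 n).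
Proof.
move=> /poly_boundP [c1 [k1 h1]] /poly_boundP [c2 [k2 h2]]; apply/poly_boundP.
exists (c1 + c2), (k1 + k2) => n; rewrite mulnDl.
by apply: leq_add; [apply: leq_trans (h1 n) _|apply: leq_trans (h2 n) _];
   rewrite leq_mul2l leq_pexp2l ?orbT ?leq_addr ?leq_addl.
Qed.

Lemma poly_mul T1 T2 : poly_bound T1 -> poly_bound T2 -> poly_bound (fun n => T1 n * T2 n).
Proof.
move=> /poly_boundP [c1 [k1 h1]] /poly_boundP [c2 [k2 h2]]; apply/poly_boundP.
exists (c1 * c2), (k1 + k2) => n.
by rewrite expnD mulnACA; apply: leq_mul.
Qed.

Lemma poly_comp T1 T2 : poly_bound T1 -> poly_bound T2 -> poly_bound (fun n => T1 (T2 n)).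
Proof.
move=> /poly_boundP [c1 [k1 h1]] /poly_boundP [c2 [k2 h2]]; apply/poly_boundP.
exists (c1 * c2.+1 ^ k1), (k2 * k1) => n; apply: leq_trans (h1 _) _.
rewrite -mulnA leq_mul2l expnM -expnMn; apply/orP; right.
case: (k1) => // k; rewrite leq_exp2r //.
have h : 0 < n.+1 ^ k2 by rewrite expn_gt0.
by have := h2 n; nia.
Qed.

(** A time bound [T] need not be monotone. This explicit majorant is, so one bound covers the calls
    of a machine on all words up to a given size. *)
Definition pol (c k n : nat) := c * n ^ k + c.

Lemma poly_pol c k : poly_bound (pol c k). Proof. by exists c, k. Qed.

Lemma pol_mono c k : {homo pol c k : m n / m <= n}.
Proof.
move=> m n mn; rewrite /pol leq_add2r leq_mul2l; apply/orP; right.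
by case: k => // k; rewrite leq_exp2r.
Qed.

Lemma poly_compile_time T : poly_bound T -> poly_bound (fun n => compile_time n (T n)).
Proof.
move=> pT; rewrite /compile_time; apply: poly_add; first exact: poly_const.
apply: poly_mul => //; apply: poly_mul; first exact: poly_const.
apply: poly_add; last exact: poly_const.
by apply: poly_add => //; apply: poly_id.
Qed.

(** * Basic fragments *)

Definition seqf (X Y : finType) (f : frag X) (g : frag Y) := bind f (fun _ => g).

Definition drain_body (i : stack) (h : bool -> frag unit) (_ : unit) : frag (unit + unit)%type :=
  bind (pop i) (fun a => if a is Some b then seqf (h b) (ret (inl tt)) else ret (inr tt)).
Definition drain i h : frag unit := loop (drain_body i h) tt.

(** [sigma w p] is the loop invariant: [w] is still on the stack, and [p] has been taken off, most
    recent bit first. *)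
Lemma exec_drain i h (sigma : word -> word -> store) t w p :
  (forall w p, get (sigma w p) i = w) ->
  (forall p, put (sigma [::] p) i [::] = sigma [::] p) ->
  (forall b w p, exec (h b) (put (sigma (b :: w) p) i w) t [:: (tt, sigma w (b :: p))]) ->
  exec (drain i h) (sigma w p) ((t + 2) * size w + 2) [:: (tt, sigma [::] (rev w ++ p))].
Proof.
move=> hg hp hh; elim: w p => [|b w IH] p.
  rewrite muln0; apply: exec_loop_exit; apply: (@exec_seq _ _ _ _ _ 1 1); first exact: exec_pop.
  by rewrite hg /= hp; apply: exec_ret.
rewrite /= mulnS -addnA; apply: (@exec_loop_next _ _ _ _ tt).
  have -> : t + 2 = 1 + (t + 1) by lia.
  apply: (@exec_seq _ _ _ _ _ 1 (t + 1)); first exact: exec_pop.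
  rewrite hg /=; apply: exec_seq; first exact: hh.
  exact: exec_ret.
by rewrite rev_cons cat_rcons; apply: IH.
Qed.

Lemma put_get s i : size s = 8 -> put s i (get s i) = s.
Proof.
move=> ss; apply: (@eq_from_nth _ [::]); first by rewrite size_set_nth ss; apply/maxn_idPr.
by move=> j _; rewrite nth_set_nth /=; case: eqP => [->|].
Qed.

Lemma put_put s i v w : put (put s i v) i w = put s i w.
Proof. by rewrite /put set_set_nth eqxx. Qed.

Lemma size_put s i w : size s = 8 -> size (put s i w) = 8.
Proof. by move=> ss; rewrite size_set_nth ss; apply/maxn_idPr. Qed.

Definition clear i : frag unit := drain i (fun _ => ret tt).

Lemma exec_clear i s t : 3 * size (get s i) + 2 <= t -> size s = 8 ->
  exec (clear i) s t [:: (tt, put s i [::])].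
Proof.
move=> ht ss.
have := @exec_drain i (fun _ => ret tt) (fun w _ => put s i w) 1 (get s i) [::].
rewrite put_get // => H; apply: (exec_mono ht); apply: H.
- by move=> w _; rewrite get_put eqxx.
- by move=> _; rewrite put_put.
- by move=> b w p; rewrite put_put; apply: exec_ret.
Qed.

(* A prefix code, so that an empty stack is distinguished from a stored blank. *)
Definition sym_bits (a : sym) : word := if a is Some b then [:: true; b] else [:: false].
Definition tape_bits (w : seq sym) : word := flatten (map sym_bits w).

Lemma size_tape_bits w : size (tape_bits w) <= 2 * size w.
Proof. by elim: w => //= -[b|] w; rewrite /tape_bits /= ; lia. Qed.

Definition popsym i : frag sym :=
  bind (pop i) (fun a => if a == Some true then pop i else ret None).
Definition pushsym i (a : sym) : frag unit :=
  if a is Some b then seqf (push i b) (push i true) else push i false.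

Lemma exec_popsym i s a w : get s i = tape_bits (a :: w) ->
  exec (popsym i) s 2 [:: (a, put s i (tape_bits w))].
Proof.
move=> e; apply: (@exec_seq _ _ _ _ _ 1 1); first exact: exec_pop.
rewrite e; case: a {e} => [b|] /=; last exact: exec_ret.
have := exec_pop i (put s i (b :: tape_bits w)).
by rewrite get_put eqxx /= put_put.
Qed.

Lemma exec_popsym0 i s : get s i = [::] ->
  exec (popsym i) s 2 [:: (None, put s i [::])].
Proof.
move=> e; apply: (@exec_seq _ _ _ _ _ 1 1); first exact: exec_pop.
by rewrite e; apply: exec_ret.
Qed.

Lemma exec_pushsym i s a w : get s i = tape_bits w ->
  exec (pushsym i a) s 2 [:: (tt, put s i (tape_bits (a :: w)))].
Proof.
move=> e; case: a => [b|] /=; last first.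
  by apply: (@exec_mono _ _ _ 1) => //; rewrite -[tape_bits _]/(false :: tape_bits w) -e; apply: exec_push.
apply: (@exec_seq _ _ _ _ _ 1 1); first exact: exec_push.
have := exec_push i true (put s i (b :: get s i)).
by rewrite get_put eqxx e put_put.
Qed.

(** The scanned symbol is kept on top of [TR] and has just been popped. Beyond the end of a list,
    popping the empty stack returns [None], which is pushed as an explicit blank. *)
Definition write_move (b : sym) (d : bool) : frag unit :=
  seqf (pushsym (if d then TL else TR) b)
    (bind (popsym (if d then TR else TL)) (pushsym TR)).

Definition conf_store (M : NTM) (io : word) (rest : store) (c : config M) : store :=
  let: (_, l, a, r) := c in io :: tape_bits l :: tape_bits (a :: r) :: rest.

Lemma exec_write_move (M : NTM) (q q' : st M) l a r b d io rest :
  exec (write_move b d) (io :: tape_bits l :: tape_bits r :: rest) 6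
    [:: (tt, conf_store io rest (apply_move ((q, l, a, r) : config M) (q', b, d)))].
Proof.
case: d; apply: (@exec_seq _ _ _ _ _ 2 4); try exact: exec_pushsym.
  case: r => [|a' r]; apply: (@exec_seq _ _ _ _ _ 2 2).
  - exact: exec_popsym0.
  - exact: (@exec_pushsym TR _ _ [::]).
  - exact: (@exec_popsym TR _ a' r).
  - exact: (@exec_pushsym TR _ _ r).
case: l => [|a' l]; apply: (@exec_seq _ _ _ _ _ 2 2).
- exact: exec_popsym0.
- exact: (@exec_pushsym TR _ _ (b :: r)).
- exact: (@exec_popsym TL _ a' l).
- exact: (@exec_pushsym TR _ _ (b :: r)).
Qed.

(** * Simulating a Turing machine *)

Section Leaves.
Variable M : NTM.

(** Dead ends are leaves too, since the simulation must return on every path of [M]; they are not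
    accepting, so the count is not affected. *)
Fixpoint leaves t (c : config M) : seq (config M) :=
  if halted c then [:: c] else
  if succs c is [::] then [:: c] else
  if t is t'.+1 then flatten [seq leaves t' c' | c' <- succs c] else [::].

Lemma count_leaves t (c : config M) : count (@accepting M) (leaves t c) = nacc t c.
Proof.
rewrite nacc_val; elim: t c => [|t IH] c /=.
  case hc: (halted c) => /=; first by rewrite addn0.
  case: (succs c) => //=; rewrite addn0; case: c hc => [[[q l] a] r] /=.
  by rewrite /accepting /=; case: eqP.
case hc: (halted c) => /=; first by rewrite addn0.
case e: (succs c) => [|c1 cs]; last by rewrite -e count_flatten -map_comp; congr sumn; apply/eq_map.
rewrite /= addn0; case: c hc {e} => [[[q l] a] r] /=.
by rewrite /accepting /=; case: eqP.
Qed.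

Lemma leaves_det t (c : config M) : deterministic M -> halts_within t c ->
  leaves t c = [:: drun t c].
Proof.
move=> dM; elim: t c => [|t IH] c /=; case: ifP => // _; first by case=> // ->.
have : size (succs c) <= 1.
  by case: c => [[[q l] a] r] /=; rewrite size_map -cardE; apply: dM.
case: (succs c) => [|c1 [|]] //= _ [//|h]; rewrite cats0; apply: IH; apply: h.
exact: mem_head.
Qed.

Definition tape_size (c : config M) := let: (_, l, _, r) := c in size l + size r.

(** A move adds at most one cell. This bounds the size of an output and the cost of clearing the
    tape stacks after a simulation. *)
Lemma tape_size_leaves t (c c' : config M) : c' \in leaves t c ->
  tape_size c' <= tape_size c + t.
Proof.
elim: t c => [|t IH] c /=; case: ifP => _.
- by rewrite inE => /eqP ->; lia.
- by case: (succs c) => // ; rewrite inE => /eqP ->; lia.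
- by rewrite inE => /eqP ->; lia.
case e: (succs c) => [|c1 cs]; first by rewrite inE => /eqP ->; lia.
rewrite -e => /flattenP [_ /mapP [c2 c2s ->]] /IH h; apply: leq_trans h _.
rewrite addnS -addSn leq_add2r.
case: c c2s {e} => [[[q l] a] r] /mapP [[[q' b] d] _ ->] /=.
by case: d; [case: r|case: l] => /=; lia.
Qed.

Lemma run_stable t t' (c : config M) : t <= t' -> halts_within t c ->
  [/\ halts_within t' c, nacc t' c = nacc t c & drun t' c = drun t c].
Proof.
move=> tt'; rewrite !nacc_val; elim: t t' c tt' => [|t IH] [|t'] c //=.
- move=> _ [hc|e]; rewrite ?hc /= ?e; first by split; [left|..].
  by case: ifP => // _; split=> //; right.
- move=> tt' [hc|h]; first by rewrite hc; split=> //; left.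
  have K c' : c' \in succs c -> _ := fun m => IH t' c' tt' (h c' m).
  split; first by right=> c' /K [].
    by case: ifP => // _; congr sumn; apply/eq_in_map => c' /K [].
  case: ifP => // _; case: (succs c) K => // c1 cs K.
  by have [] := K c1 (mem_head _ _).
Qed.

End Leaves.

Section Simulate.
Variable M : NTM.

Definition sim_body (q : st M) : frag (st M + bool)%type :=
  if (q == @qacc M) || (q == @qrej M) then ret (inr (q == @qacc M))
  else bind (popsym TR) (fun a =>
    if enum (@delta M q a) is [::] then seqf (pushsym TR a) (ret (inr false))
    else bind (guess (enum (@delta M q a)))
           (fun m => seqf (write_move m.1.2 m.2) (ret (inl m.1.1)))).

Definition conf_state (c : config M) : st M := c.1.1.1.

Lemma exec_sim_body io rest (c : config M) : ~~ halted c -> succs c != [::] ->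
  exec (sim_body (conf_state c)) (conf_store io rest c) 10
    [seq (inl (conf_state c'), conf_store io rest c') | c' <- succs c].
Proof.
case: c => [[[q l] a] r] /= hc; rewrite /sim_body /conf_state /= (negPf hc).
rewrite -map_comp => hs.
apply: (@exec_seq _ _ _ _ _ 2 8); first by apply: (@exec_popsym TR _ a r).
case e: (enum _) hs => [//|m ms] _; rewrite -e => {e}.
rewrite (_ : [seq _ | i <- _] = flatten [seq [:: (inl m.1.1, conf_store io rest
  (apply_move ((q, l, a, r) : config M) m))] | m <- enum (@delta M q a)]); last first.
  elim: (enum _) => //= -[[q' b] d] ms' -> /=; congr cons; congr pair.
  by case: d; [case: r|case: l].
apply: exec_guess_bind => -[[q' b] d] _ /=.
by apply: (@exec_seq _ _ _ _ _ 6 1); [apply: exec_write_move|apply: exec_ret].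
Qed.

Lemma exec_sim_loop io rest t (c : config M) : halts_within t c ->
  exec (loop sim_body (conf_state c)) (conf_store io rest c) (10 * t + 10)
    [seq (accepting c', conf_store io rest c') | c' <- leaves t c].
Proof.
have Hhalt (c' : config M) : halted c' -> exec (loop sim_body (conf_state c'))
    (conf_store io rest c') 10 [:: (accepting c', conf_store io rest c')].
  move=> hc; apply: (@exec_mono _ _ _ 1) => //; apply: exec_loop_exit.
  by case: c' hc => [[[q l] a] r] /= hc; rewrite /sim_body /conf_state /= hc; apply: exec_ret.
have Hdead (c' : config M) : ~~ halted c' -> succs c' = [::] ->
    exec (loop sim_body (conf_state c'))
    (conf_store io rest c') 10 [:: (accepting c', conf_store io rest c')].
  move=> hc sc; apply: (@exec_mono _ _ _ 5) => //; apply: exec_loop_exit.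
  case: c' hc sc => [[[q l] a] r] /= hc; rewrite /sim_body /conf_state /= (negPf hc) => sc.
  apply: (@exec_seq _ _ _ _ _ 2 3); first by apply: (@exec_popsym TR _ a r).
  case: (enum _) sc => // _.
  have -> : accepting (q, l, a, r) = false by move: hc; rewrite /accepting /=; case: eqP.
  by apply: (@exec_seq _ _ _ _ _ 2 1); [apply: (@exec_pushsym TR _ a r)|apply: exec_ret].
elim: t c => [|t IH] c /=.
  move=> h; case: ifP h => [hc _|/negbT hc [//|sc]]; first exact: Hhalt.
  by rewrite sc; apply: Hdead.
move=> h; case: ifP h => [hc _|/negbT hc [//|h]].
  by apply: exec_mono (Hhalt c hc); lia.
case e: (succs c) => [|c1 cs].
  by apply: exec_mono (Hdead c hc e); lia.
rewrite -e.
have := @exec_loop _ _ sim_body (conf_state c) (conf_store io rest c) 10 (10 * t + 10)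
  _ (fun y => if y.1 is inl q then
    run (@fcode _ (loop sim_body q)) (10 * t + 10) (inl (fentry (loop sim_body q))) y.2 else [::])
  (@exec_sim_body io rest c hc _).
rewrite -map_comp e => /(_ isT) H.
apply: (@exec_mono _ _ _ (10 + (10 * t + 10))); first by lia.
rewrite -e.
have -> : [seq (accepting c', conf_store io rest c') | c' <- flatten [seq leaves t c' | c' <- succs c]] =
  flatten [seq [seq (accepting c', conf_store io rest c') | c' <- leaves t c2] | c2 <- succs c].
  by elim: (succs c) => //= c2 cs' IHc; rewrite map_cat IHc.
have K c2 : c2 \in succs c -> _ := fun m => IH c2 (h c2 m).
rewrite (_ : [seq _ | c2 <- succs c] =
  [seq run (@fcode _ (loop sim_body (conf_state c2))) (10 * t + 10)
     (inl (fentry (loop sim_body (conf_state c2)))) (conf_store io rest c2) | c2 <- succs c]).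
  by rewrite e; apply: H => y /mapP [c2]; rewrite -e => /K [h2 r2] -> /=; split.
by apply/eq_in_map => c2 /K [_ <-].
Qed.

(** The initial pop and push make the scanned blank of an empty input explicit. *)
Definition sim : frag bool :=
  seqf (bind (popsym TR) (pushsym TR)) (loop sim_body (@start M)).

Lemma exec_norm_tape x io rest :
  exec (bind (popsym TR) (pushsym TR)) (io :: [::] :: tape_bits (map Some x) :: rest) 4
    [:: (tt, conf_store io rest (init M x))].
Proof.
case: x => [|b x] /=; apply: (@exec_seq _ _ _ _ _ 2 2).
- exact: exec_popsym0.
- exact: (@exec_pushsym TR _ _ [::]).
- exact: (@exec_popsym TR _ _ (map Some x)).
- exact: (@exec_pushsym TR _ _ (map Some x)).
Qed.

Lemma exec_sim io rest x t : halts_within t (init M x) ->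
  exec sim (io :: [::] :: tape_bits (map Some x) :: rest) (10 * t + 14)
    [seq (accepting c', conf_store io rest c') | c' <- leaves t (init M x)].
Proof.
move=> h; rewrite addnC -[14]/(4 + 10) -addnA [10 + _]addnC.
apply: exec_seq; first exact: exec_norm_tape.
by have := exec_sim_loop io rest h; case: (x).
Qed.

(** Clearing both tape stacks lets all paths end in the same store, which is what makes the path
    counts of consecutive calls multiply. *)
Definition call : frag bool :=
  bind sim (fun b => seqf (clear TL) (seqf (clear TR) (ret b))).

Definition call_time (n t : nat) := 30 * (n + t) + 40.

Lemma tape_size_init x : tape_size (init M x) <= size x.
Proof. by case: x => //= b x; rewrite size_map; lia. Qed.

Lemma exec_call io rest x t : halts_within t (init M x) -> size rest = 5 ->
  exec call (io :: [::] :: tape_bits (map Some x) :: rest) (call_time (size x) t)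
    [seq (accepting c, io :: [::] :: [::] :: rest) | c <- leaves t (init M x)].
Proof.
move=> h sr; have H := exec_sim io rest h.
rewrite (_ : [seq _ | c <- _] = flatten (map (fun y : bool * store => [:: (y.1, io :: [::] :: [::] :: rest)])
  [seq (accepting c', conf_store io rest c') | c' <- leaves t (init M x)])); last first.
  by elim: leaves => //= c l ->.
apply: (@exec_mono _ _ _ ((10 * t + 14) + (20 * (size x + t) + 20))).
  by rewrite /call_time; lia.
apply: exec_bind H _ => _ /mapP [c /tape_size_leaves hc ->] /=.
have := leq_trans hc (leq_add (tape_size_init x) (leqnn t)).
case: c {hc} => [[[q l] a] r] /= hc.
have hl : size (tape_bits l) <= 2 * (size x + t).
  by apply: leq_trans (size_tape_bits _) _; rewrite leq_mul2l; apply: leq_trans hc; apply: leq_addr.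
have hr : size (tape_bits (a :: r)) <= 2 * (size x + t).+1.
  by apply: leq_trans (size_tape_bits _) _; rewrite leq_mul2l ltnS; apply: leq_trans hc; apply: leq_addl.
set n1 := size (tape_bits l) in hl *; set n2 := size (tape_bits (a :: r)) in hr *.
apply: (@exec_mono _ _ _ (3 * n1 + 2 + (3 * n2 + 2 + 1))); first by lia.
apply: exec_seq; first by apply: exec_clear; rewrite ?sr //= sr.
apply: exec_seq; first by apply: exec_clear; rewrite ?sr //= sr.
exact: exec_ret.
Qed.

Lemma exec_call_det io rest x t : deterministic M -> halts_within t (init M x) -> size rest = 5 ->
  exec call (io :: [::] :: tape_bits (map Some x) :: rest) (call_time (size x) t)
    [:: (0 < nacc t (init M x), io :: [::] :: [::] :: rest)].
Proof.
move=> dM h sr; have := exec_call io h sr; rewrite -count_leaves (leaves_det dM h) /=.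
by case: (accepting _).
Qed.

End Simulate.

(** * Clocks *)

Fixpoint pushn i b n : frag unit :=
  if n is n'.+1 then seqf (push i b) (pushn i b n') else ret tt.

Lemma exec_pushn i b n s : size s = 8 ->
  exec (pushn i b n) s (n + 1) [:: (tt, put s i (nseq n b ++ get s i))].
Proof.
elim: n s => [|n IH] s ss /=; first by rewrite put_get //; apply: exec_ret.
rewrite addSn -add1n; apply: exec_seq; first exact: exec_push.
have := IH (put s i (b :: get s i)) (size_put _ _ ss); rewrite get_put eqxx put_put.
suff -> : nseq n b ++ b :: get s i = b :: nseq n b ++ get s i by [].
by elim: (n) => //= n' ->.
Qed.

Lemma det_drain i h : (forall b, det_frag (h b)) -> det_frag (drain i h).
Proof.
move=> dh; apply: det_loop => -[]; apply: det_bind; first exact: det_pop.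
by case=> [b|]; [apply: det_bind|apply: det_ret].
Qed.

Lemma det_pushn i b n : det_frag (pushn i b n).
Proof. by elim: n => [|n IH]; [apply: det_ret|apply: det_bind]. Qed.

(** Multiplies the unary number on [WS] by the one on [XS]. The product accumulates on [ZS], while
    [YS] holds the copy from which [XS] is restored in each round. *)
Definition mul_step : frag unit :=
  seqf (drain WS (fun _ =>
    seqf (drain XS (fun _ => seqf (push ZS true) (push YS true)))
         (drain YS (fun _ => push XS true))))
  (drain ZS (fun _ => push WS true)).

Lemma exec_mul_step io tl tr a m u :
  exec mul_step [:: io; tl; tr; nseq m true; nseq u true; [::]; a; [::]]
    (10 * (u * m) + 6 * u + 4)
    [:: (tt, [:: io; tl; tr; nseq m true; nseq (u * m) true; [::]; a; [::]])].
Proof.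
have H1 (w : word) z : exec (seqf (drain XS (fun _ => seqf (push ZS true) (push YS true)))
         (drain YS (fun _ => push XS true)))
     [:: io; tl; tr; nseq m true; w; nseq z true; a; [::]] (7 * m + 4)
     [:: (tt, [:: io; tl; tr; nseq m true; w; nseq (m + z) true; a; [::]])].
  have -> : 7 * m + 4 = (2 + 2) * m + 2 + ((1 + 2) * m + 2) by lia.
  apply: (@exec_seq _ _ _ _ _ _ _ tt [:: io; tl; tr; [::]; w; nseq (m + z) true; a; nseq m true]).
    have := @exec_drain XS (fun _ => seqf (push ZS true) (push YS true))
      (fun v p => [:: io; tl; tr; v; w; nseq (size p + z) true; a; nseq (size p) true])
      2 (nseq m true) [::].
    by rewrite cats0 size_rev size_nseq; apply.
  have := @exec_drain YS (fun _ => push XS true)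
    (fun v p => [:: io; tl; tr; nseq (size p) true; w; nseq (m + z) true; a; v])
    1 (nseq m true) [::].
  by rewrite cats0 size_rev size_nseq; apply.
apply: (@exec_mono _ _ _ ((7 * m + 4 + 2) * u + 2 + ((1 + 2) * (u * m) + 2))); first by nia.
apply: (@exec_seq _ _ _ _ _ _ _ tt [:: io; tl; tr; nseq m true; [::]; nseq (u * m) true; a; [::]]).
  have := @exec_drain WS (fun _ =>
    seqf (drain XS (fun _ => seqf (push ZS true) (push YS true)))
         (drain YS (fun _ => push XS true)))
    (fun v p => [:: io; tl; tr; nseq m true; v; nseq (size p * m) true; a; [::]])
    (7 * m + 4) (nseq u true) [::].
  rewrite cats0 size_rev size_nseq; apply=> // b v p; exact: H1.
have := @exec_drain ZS (fun _ => push WS true)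
  (fun v p => [:: io; tl; tr; nseq m true; nseq (size p) true; v; a; [::]])
  1 (nseq (u * m) true) [::].
by rewrite cats0 size_rev size_nseq; apply.
Qed.

Lemma det_mul_step : det_frag mul_step.
Proof. by repeat (apply det_bind || apply det_drain || intro). Qed.

Fixpoint pow_clock k : frag unit :=
  if k is k'.+1 then seqf (pow_clock k') mul_step else push WS true.

Lemma exec_pow_clock io tl tr a m k : 0 < m ->
  exec (pow_clock k) [:: io; tl; tr; nseq m true; [::]; [::]; a; [::]]
    (20 * k * m ^ k + 1)
    [:: (tt, [:: io; tl; tr; nseq m true; nseq (m ^ k) true; [::]; a; [::]])].
Proof.
move=> m0; elim: k => [|k IH]; first exact: exec_push.
apply: (@exec_mono _ _ _ ((20 * k * m ^ k + 1) + (10 * (m ^ k * m) + 6 * m ^ k + 4))).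
  have h : m ^ k <= m ^ k.+1 by rewrite leq_pexp2l.
  rewrite -expnSr; have := expn_gt0 m k; rewrite m0 /= => h0.
  have : k * m ^ k <= k * m ^ k.+1 by rewrite leq_mul2l h orbT.
  by lia.
by rewrite expnSr; apply: exec_seq IH (exec_mul_step _ _ _ _ _ _).
Qed.

Lemma det_pow_clock k : det_frag (pow_clock k).
Proof. by elim: k => [|k IH]; [|apply: det_bind => // _; apply: det_mul_step]. Qed.

(* The input is read from its last bit on, so that pushing it leaves its first
   bit on top of [TR]. *)
Definition load : frag unit :=
  drain IO (fun b => seqf (pushsym TR (Some b)) (push XS true)).

Lemma exec_load x rest : size rest = 4 ->
  exec load (rev x :: [::] :: [::] :: [::] :: rest) (5 * size x + 2)
    [:: (tt, [::] :: [::] :: tape_bits (map Some x) :: nseq (size x) true :: rest)].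
Proof.
move=> sr; have := @exec_drain IO (fun b => seqf (pushsym TR (Some b)) (push XS true))
  (fun w p => w :: [::] :: tape_bits (map Some p) :: nseq (size p) true :: rest) 3 (rev x) [::].
by rewrite cats0 revK size_rev; apply.
Qed.

(** * Counting complementary paths *)

(** The class #P, with the clock in the monotone form [pol]. *)
Definition sharp (h : word -> nat) := exists (M : NTM) c k, forall x,
  halts_within (pol c k (size x)) (init M x) /\
  nacc (pol c k (size x)) (init M x) = h x.

Lemma sharp_compile F T h : poly_bound T ->
  (forall x, cnt F (start_store x) (T (size x)) (h x)) -> sharp h.
Proof.
move=> /poly_compile_time [c [k pT]] H; exists (compile F), c, k => x.
exact: compile_cnt (H x) (pT _).
Qed.

Section Complement.
Variables (M : NTM) (D : nat).

(* Every simulated step takes one unit [u] off the clock [WS] and branches in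
   exactly [D] ways; the branches not used by [M] enter state [inr false], which
   has [D ^ u] accepting paths, while an accepting configuration enters
   [inr true], which has one path less.  So the whole has [D ^ u] minus the
   number of accepting paths of [M]. *)
Definition comp_body (a : (st M + bool)%type) : frag ((st M + bool) + bool)%type :=
  match a with
  | inl q =>
    if (q == @qacc M) || (q == @qrej M) then ret (inl (inr (q == @qacc M))) else
    bind (pop WS) (fun o => if o is None then ret (inr true) else
    bind (popsym TR) (fun a =>
    bind (guess (map Some (enum (@delta M q a)) ++ nseq (D - #|@delta M q a|) None))
      (fun m => if m is Some m then seqf (write_move m.1.2 m.2) (ret (inl (inl m.1.1)))
                else ret (inl (inr false)))))
  | inr b =>
    bind (pop WS) (fun o => if o is None then ret (inr (~~ b)) else
    bind (guess (b :: nseq D.-1 false)) (fun b' => ret (inl (inr b'))))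
  end.

Hypothesis D_gt0 : 0 < D.
Hypothesis D_delta : forall q a, #|@delta M q a| <= D.

(** By [D ^ u.+1 - b = (D ^ u - b) + D.-1 * D ^ u]: the missing path is handed to exactly one of the
    [D] branches. *)
Lemma cnt_comp_tail b io tl tr xs rest u :
  cnt (loop comp_body (inr b)) [:: io, tl, tr, xs, nseq u true & rest] (4 * u + 4) (D ^ u - b).
Proof.
elim: u b => [|u IH] b.
  apply: (@cnt_mono _ _ 4) => //; rewrite (_ : D ^ 0 - b = ~~ b); last by case: b.
  apply: (@cnt_loop_exit _ _ _ _ _ [:: io, tl, tr, xs, [::] & rest]).
  apply: (@exec_seq _ _ _ _ _ 1 3); first exact: exec_pop.
  by apply: (@exec_mono _ _ _ 1) => //; apply: exec_ret.
have -> : D ^ u.+1 - b = sumn [seq D ^ u - nat_of_bool b' | b' <- b :: nseq D.-1 false].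
  rewrite /= map_nseq sumn_nseq /= subn0 expnS.
  have h : 0 < D ^ u by rewrite expn_gt0 D_gt0.
  by case: (D) D_gt0 => // d _; case: b; rewrite /= ?subn0 mulSn; nia.
apply: (@cnt_mono _ _ (4 + (4 * u + 4))); first by lia.
apply: (@cnt_loop _ _ _ _ _ _ _ _ (fun b' => inl (inr b')) (fun _ => [:: io, tl, tr, xs, nseq u true & rest])); last by move=> b' _; apply: IH.
apply: (@exec_seq _ _ _ _ _ 1 3); first exact: exec_pop.
rewrite -flatten_map1.
by apply: exec_guess_bind => b' _; apply: (@exec_mono _ _ _ 1) => //; apply: exec_ret.
Qed.

Lemma sumn_sub (T : eqType) (f : T -> nat) n (l : seq T) : {in l, forall x, f x <= n} ->
  sumn [seq n - f x | x <- l] + sumn [seq f x | x <- l] = n * size l.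
Proof.
elim: l => [|x l IH] H /=; first by rewrite muln0.
rewrite mulnS -IH => [|y yl]; last by apply: H; rewrite inE yl orbT.
by have := H x (mem_head _ _); lia.
Qed.

Lemma conf_state_move (c : config M) m : conf_state (apply_move c m) = m.1.1.
Proof. by case: c m => [[[q l] a] r] [[q' b] []]; [case: r|case: l]. Qed.

(** The used branches contribute [D ^ u - N c'] each and the padding branches [D ^ u] each, which
    adds up to [D ^ u.+1] minus the sum of the [N c']. The bound on [N] is carried along because
    subtraction is truncated. *)
Lemma cnt_comp_step io xs rest u (c : config M) (N : config M -> nat) : ~~ halted c ->
  {in succs c, forall c', N c' <= D ^ u /\
     cnt (loop comp_body (inl (conf_state c')))
       (conf_store io [:: xs, nseq u true & rest] c') (12 * u + 12) (D ^ u - N c')} ->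
  sumn (map N (succs c)) <= D ^ u.+1 /\
  cnt (loop comp_body (inl (conf_state c)))
    (conf_store io [:: xs, nseq u.+1 true & rest] c) (12 * u.+1 + 12)
    (D ^ u.+1 - sumn (map N (succs c))).
Proof.
case: c => [[[q l] a] r] hc IH.
have IHm m : m \in enum (@delta M q a) -> _ := fun h => IH _ (map_f (apply_move ((q, l, a, r) : config M)) h).
pose ms := map Some (enum (@delta M q a)) ++ nseq (D - #|@delta M q a|) None.
pose n m := if m is Some m then D ^ u - N (apply_move ((q, l, a, r) : config M) m) else D ^ u.
have [hle hsum] : sumn (map N (succs ((q, l, a, r) : config M))) <= D ^ u.+1 /\
    D ^ u.+1 - sumn (map N (succs ((q, l, a, r) : config M))) = sumn (map n ms).
  have := @sumn_sub _ N (D ^ u) (succs ((q, l, a, r) : config M)) (fun c' h => (IH c' h).1).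
  have -> : sumn (map n ms) = sumn [seq D ^ u - N c' | c' <- succs ((q, l, a, r) : config M)]
      + (D - #|@delta M q a|) * D ^ u.
    by rewrite /ms map_cat map_nseq sumn_cat sumn_nseq /= -!map_comp mulnC.
  have -> : size (succs ((q, l, a, r) : config M)) = #|@delta M q a| by rewrite size_map -cardE.
  have e : D ^ u.+1 = D ^ u * #|@delta M q a| + (D - #|@delta M q a|) * D ^ u.
    by rewrite [X in X + _]mulnC -mulnDl subnKC ?D_delta // expnS.
  by rewrite e; move: (sumn _) => S1; move: (sumn _) => S2; lia.
split=> //; rewrite hsum {hle hsum}.
apply: (@cnt_mono _ _ (12 + (12 * u + 12))); first by lia.
pose z (m : option (st M * sym * bool)) : ((st M + bool) + bool)%type :=
  if m is Some m then inl (inl m.1.1) else inl (inr false).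
pose s' (m : option (st M * sym * bool)) :=
  if m is Some m then conf_store io [:: xs, nseq u true & rest] (apply_move ((q, l, a, r) : config M) m)
  else [:: io, tape_bits l, tape_bits r, xs, nseq u true & rest].
apply: (@cnt_loop _ _ _ _ _ _ _ ms z s' n); last first.
  move=> [m|]; rewrite mem_cat => /orP [].
  - move=> /mapP [m' /IHm [_ H] [->]]; rewrite /z /n /=.
    by move: H; rewrite conf_state_move.
  - by rewrite mem_nseq andbF.
  - by case/mapP.
  - move=> _; rewrite /n /z -[D ^ u]subn0.
    by apply: cnt_mono (cnt_comp_tail false _ _ _ _ _ _); lia.
move: hc => /= /negPf hc; rewrite /conf_state /= hc.
apply: (@exec_seq _ _ _ _ _ 1 11); first exact: exec_pop.
apply: (@exec_seq _ _ _ _ _ 2 9); first exact: (@exec_popsym TR _ a r).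
rewrite -(flatten_map1 (fun m => (z m, s' m))); apply: exec_guess_bind => -[[[q' b] d]|] _.
  by apply: (@exec_seq _ _ _ _ _ 6 2); [apply: exec_write_move|apply: (@exec_mono _ _ _ 1) => //; apply: exec_ret].
by apply: (@exec_mono _ _ _ 1) => //; apply: exec_ret.
Qed.

Lemma cnt_comp_loop io xs rest t u (c : config M) : halts_within t c -> t <= u ->
  nacc t c <= D ^ u /\
  cnt (loop comp_body (inl (conf_state c)))
    (conf_store io [:: xs, nseq u true & rest] c) (12 * u + 12) (D ^ u - nacc t c).
Proof.
have D_pow n : 0 < D ^ n by rewrite expn_gt0 D_gt0.
have Hhalt v (c' : config M) t' : halted c' -> nacc t' c' <= D ^ v /\
    cnt (loop comp_body (inl (conf_state c')))
    (conf_store io [:: xs, nseq v true & rest] c') (12 * v + 12) (D ^ v - nacc t' c').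
  case: c' => [[[q l] a] r] hc.
  have -> : nacc t' ((q, l, a, r) : config M) = (q == @qacc M).
    by rewrite nacc_val; case: t' => [|t'] /=; move: hc => /= ->.
  split; first by case: eqP => // _; apply: D_pow.
  apply: (@cnt_mono _ _ (1 + (4 * v + 4))); first by lia.
  apply: (cnt_loop_next (s' := conf_store io [:: xs, nseq v true & rest] ((q, l, a, r) : config M)));
    last exact: cnt_comp_tail.
  by rewrite /conf_state /=; move: hc => /= ->; apply: exec_ret.
elim: t u c => [|t IH] u c hc tu; (have [hq|hq] := boolP (halted c); first exact: Hhalt).
- have sc : succs c = [::] by case: hc => //; rewrite (negPf hq).
  have -> : nacc 0 c = sumn (map (fun _ => 0) (succs c)).
    by rewrite nacc_val /= (negPf hq) sc.
  (* A dead end may be met with the clock already at zero. The empty clock then yields one accepting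
     path, which is [D ^ 0 - 0]. *)
  case: u tu => [_|u _]; last by apply: cnt_comp_step => // c'; rewrite sc.
  rewrite sc; split=> //; apply: (@cnt_mono _ _ 5) => //.
  case: c hq {sc hc} => [[[q l] a] r] /= /negPf hq.
  apply: (@cnt_loop_exit _ _ _ true [:: io, tape_bits l, tape_bits (a :: r), xs, [::] & rest]).
  rewrite /conf_state /= hq; apply: (@exec_seq _ _ _ _ _ 1 4); first exact: exec_pop.
  by apply: (@exec_mono _ _ _ 1) => //; apply: exec_ret.
- have -> : nacc t.+1 c = sumn (map (nacc t) (succs c)).
    rewrite nacc_val /= (negPf hq); congr sumn; apply/eq_map => c'; by rewrite nacc_val.
  have h : forall c', c' \in succs c -> halts_within t c'.
    by case: hc => //; rewrite (negPf hq).
  case: u tu => // u tu; apply: cnt_comp_step => // c' /h hc'; exact: IH.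
Qed.

Definition complement : frag bool :=
  seqf (bind (popsym TR) (pushsym TR)) (loop comp_body (inl (@start M))).

Lemma cnt_complement io xs rest t u x : halts_within t (init M x) -> t <= u ->
  nacc t (init M x) <= D ^ u /\
  cnt complement [:: io, [::], tape_bits (map Some x), xs, nseq u true & rest]
    (12 * u + 16) (D ^ u - nacc t (init M x)).
Proof.
move=> h tu; have [hle hc] := @cnt_comp_loop io xs rest t u _ h tu; split=> //.
rewrite -[16]/(12 + 4) addnA addnC.
by apply: cnt_seq; [apply: exec_norm_tape|case: (x) hc].
Qed.

End Complement.

(** * Equality of #P functions *)

Lemma FP_word_compile (F : frag bool) T g : det_frag F -> poly_bound T ->
  (forall x, exists (b : bool) s, exec F (start_store x) (T (size x)) [:: (b, s)] /\ get s IO = rev (g x)) ->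
  FP_word g.
Proof.
move=> dF pT H; exists (compile F), (fun n => compile_time n (T n)); split.
- exact: compile_det.
- exact: poly_compile_time.
- move=> x; have [b [s [ex _]]] := H x; exact: (compile_output dF ex (leqnn _)).1.
- move=> x; have [b [s [ex e]]] := H x.
  by rewrite (compile_output dF ex (leqnn _)).2 e revK.
Qed.

Lemma nat_of_bits_rcons w b : nat_of_bits (rcons w b) = (nat_of_bits w).*2 + b.
Proof. by rewrite /nat_of_bits -cats1 foldl_cat. Qed.

Lemma nat_of_bits_pow2 n : nat_of_bits (true :: nseq n false) = 2 ^ n.
Proof.
elim: n => // n IH.
have -> : true :: nseq n.+1 false = rcons (true :: nseq n false) false.
  by rewrite /=; congr cons; elim: (n) => //= m <-.
by rewrite nat_of_bits_rcons IH addn0 expnS mul2n.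
Qed.

Section Equality.
Variables (d k b : nat).

Definition clock : frag unit := seqf (pushn XS true d.+1) (pow_clock k).

Definition clock_time (n : nat) := (d.+1 + 1) + (20 * k * (d.+1 + n) ^ k + 1).

Lemma exec_clock io tl tr n a :
  exec clock [:: io; tl; tr; nseq n true; [::]; [::]; a; [::]] (clock_time n)
    [:: (tt, [:: io; tl; tr; nseq (d.+1 + n) true; nseq ((d.+1 + n) ^ k) true; [::]; a; [::]])].
Proof.
apply: exec_seq; first exact: exec_pushn.
by rewrite /put /get -[nth _ _ _]/(nseq n true) -nseqD; apply: exec_pow_clock.
Qed.

Lemma poly_clock_time : poly_bound clock_time.
Proof.
apply: poly_add; first exact: poly_const.
apply: poly_add; last exact: poly_const.
apply: poly_mul; first exact: poly_const.
apply: (@poly_comp (fun n => n ^ k)).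
  by exists 1, k => n; rewrite mul1n leq_addr.
by apply: poly_add; [apply: poly_const|apply: poly_id].
Qed.

Definition power_prog : frag bool :=
  seqf (drain IO (fun _ => push XS true)) (seqf clock
    (seqf (push IO true) (seqf (drain WS (fun _ => pushn IO false b)) (ret true)))).

(** With a power of two as branching degree, the bound is written in binary as a one followed by [b]
    zeros for every unit of the clock, so no arithmetic on binary numbers is required. *)
Lemma FP_power : FP_nat (fun x => (2 ^ b) ^ ((d.+1 + size x) ^ k)).
Proof.
exists (fun x => true :: nseq (b * (d.+1 + size x) ^ k) false).
split; last by move=> x; rewrite nat_of_bits_pow2 expnM.
apply: (@FP_word_compile power_prog
  (fun n => (3 * n + 2) + (clock_time n + (1 + (((b + 1 + 2) * (d.+1 + n) ^ k + 2) + 1))))).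
- by repeat (apply det_bind || apply det_drain || apply det_pushn ||
              apply det_pow_clock || intro).
- apply: poly_add.
    by apply: poly_add; [apply: poly_mul; [apply: poly_const|apply: poly_id]|apply: poly_const].
  apply: poly_add; first exact: poly_clock_time.
  apply: poly_add; first exact: poly_const.
  apply: poly_add; last exact: poly_const.
  apply: poly_add; last exact: poly_const.
  apply: poly_mul; first exact: poly_const.
  apply: (@poly_comp (fun n => n ^ k)).
    by exists 1, k => n; rewrite mul1n leq_addr.
  by apply: poly_add; [apply: poly_const|apply: poly_id].
move=> x; set r := (d.+1 + size x) ^ k.
exists true, [:: nseq (b * r) false ++ [:: true]; [::]; [::]; nseq (d.+1 + size x) true; [::]; [::]; [::]; [::]].
split; last first.
  by rewrite rev_cons rev_nseq -cats1.
apply: (exec_seq (s' := [:: [::]; [::]; [::]; nseq (size x) true; [::]; [::]; [::]; [::]])).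
  have := @exec_drain IO (fun _ => push XS true)
    (fun w p => [:: w; [::]; [::]; nseq (size p) true; [::]; [::]; [::]; [::]]) 1 (rev x) [::].
  by rewrite cats0 !size_rev; apply.
apply: exec_seq; first exact: exec_clock.
apply: exec_seq; first exact: exec_push.
apply: exec_seq; last exact: exec_ret.
have := @exec_drain WS (fun _ => pushn IO false b)
  (fun w p => [:: nseq (b * size p) false ++ [:: true]; [::]; [::]; nseq (d.+1 + size x) true; w; [::]; [::]; [::]])
  (b + 1) (nseq r true) [::].
rewrite cats0 size_rev size_nseq muln0; apply=> // c w p.
have := @exec_pushn IO false b [:: nseq (b * size p) false ++ [:: true]; [::]; [::]; nseq (d.+1 + size x) true; w; [::]; [::]; [::]] (erefl _).
by rewrite [size (_ :: _)]/= mulnS (nseqD b (b * size p)) -catA.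
Qed.

Variables (M1 M2 : NTM).
Definition equal_prog : frag bool :=
  seqf load (bind (guess [:: true; false]) (fun s =>
    if s then sim M1 else seqf clock (complement M2 (2 ^ b)))).

Lemma cnt_equal_prog t1 t2 x : (forall q a, #|@delta M2 q a| <= 2 ^ b) ->
  halts_within t1 (init M1 x) -> halts_within t2 (init M2 x) ->
  t2 <= (d.+1 + size x) ^ k ->
  nacc t2 (init M2 x) <= (2 ^ b) ^ ((d.+1 + size x) ^ k) /\
  cnt equal_prog (start_store x)
    ((5 * size x + 2) + (1 + ((10 * t1 + 14) + (clock_time (size x) + (12 * (d.+1 + size x) ^ k + 16)))))
    (nacc t1 (init M1 x) + ((2 ^ b) ^ ((d.+1 + size x) ^ k) - nacc t2 (init M2 x))).
Proof.
move=> hb h1 h2 ht.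
have b0 : 0 < 2 ^ b by rewrite expn_gt0.
have [hle hc] := @cnt_complement M2 (2 ^ b) b0 hb [::]
  (nseq (d.+1 + size x) true) [:: [::]; [::]; [::]] t2 _ x h2 ht.
split=> //.
apply: cnt_seq; first exact: (@exec_load x [:: [::]; [::]; [::]; [::]]).
pose s := [:: [::]; [::]; tape_bits (map Some x); nseq (size x) true; [::]; [::]; [::]; [::]].
have := @cnt_bind _ _ (guess [:: true; false]) (fun s => if s then sim M1 else seqf clock (complement M2 (2 ^ b)))
  s 1 ((10 * t1 + 14) + (clock_time (size x) + (12 * (d.+1 + size x) ^ k + 16)))
  [:: true; false] id (fun _ => s) (fun c => if c then nacc t1 (init M1 x) else (2 ^ b) ^ ((d.+1 + size x) ^ k) - nacc t2 (init M2 x))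
  (exec_guess _ _).
rewrite /= addn0; apply=> c; rewrite !inE => /orP [] /eqP -> /=.
  apply: (@cnt_mono _ _ (10 * t1 + 14)); first exact: leq_addr.
  exists [seq (accepting c', conf_store [::] (drop 3 s) c') | c' <- leaves t1 (init M1 x)].
    exact: exec_sim.
  by rewrite count_map -count_leaves; apply: eq_count.
apply: (@cnt_mono _ _ (clock_time (size x) + (12 * (d.+1 + size x) ^ k + 16))); first exact: leq_addl.
by apply: cnt_seq hc; apply: exec_clock.
Qed.

End Equality.

Lemma ceqP_sharp h1 h2 L : sharp h1 -> sharp h2 -> (forall x, L x <-> h1 x = h2 x) -> inCeqP L.
Proof.
move=> [M1 [c1 [k1 H1]]] [M2 [c2 [k2 H2]]] HL.
(* The number of all possible moves; [2 ^ b] exceeds it and hence bounds the branching of [M2]. *)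
pose b := #|{: st M2 * sym * bool}|.
(* A pure power dominating [pol c2 k2], as [pow_clock] produces: with [m = (2 * c2).+1 + n] one has
   [c2 * n ^ k2 + c2 <= 2 * c2 * m ^ k2 <= m ^ k2.+1]. *)
pose r n := ((2 * c2).+1 + n) ^ k2.+1.
have hr n : pol c2 k2 n <= r n.
  rewrite /pol /r; set m := (2 * c2).+1 + n.
  have a1 : n ^ k2 <= m ^ k2 by case: (k2) => // k; rewrite leq_exp2r // leq_addl.
  have a2 : 0 < m ^ k2 by rewrite expn_gt0.
  have a3 : 2 * c2 <= m by rewrite /m; lia.
  by rewrite expnS; nia.
have hb q a : #|@delta M2 q a| <= 2 ^ b.
  by apply: leq_trans (max_card _) _; apply: ltnW; apply: ltn_expl.
have main x := @cnt_equal_prog (2 * c2) k2.+1 b M1 M2 _ _ x hb (H1 x).1 (H2 x).1 (hr (size x)).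
pose T n := (5 * n + 2) + (1 + ((10 * pol c1 k1 n + 14) + (clock_time (2 * c2) k2.+1 n + (12 * r n + 16)))).
exists (fun x => (2 ^ b) ^ r (size x)), (compile (equal_prog (2 * c2) k2.+1 b M1 M2)), (fun n => compile_time n (T n)).
split.
- exact: FP_power.
- apply: poly_compile_time; rewrite /T.
  have pr : poly_bound r.
    apply: (@poly_comp (fun n => n ^ k2.+1)).
      by exists 1, k2.+1 => n; rewrite mul1n leq_addr.
    by apply: poly_add; [apply: poly_const|apply: poly_id].
  apply: poly_add.
    by apply: poly_add; [apply: poly_mul; [apply: poly_const|apply: poly_id]|apply: poly_const].
  apply: poly_add; first exact: poly_const.
  apply: poly_add.
    by apply: poly_add; [apply: poly_mul; [apply: poly_const|apply: poly_pol]|apply: poly_const].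
  apply: poly_add; first exact: poly_clock_time.
  by apply: poly_add; [apply: poly_mul; [apply: poly_const|]|apply: poly_const].
- by move=> x; have [_ /compile_cnt /(_ (leqnn _)) []] := main x.
- move=> x; have [hle /compile_cnt /(_ (leqnn _)) [_ ->]] := main x.
  rewrite HL -(H1 x).2 -(H2 x).2 -/(r (size x)).
  by move: hle; rewrite -/(r (size x)) => hle; split; lia.
Qed.

(** * NP inside parallel access to NP *)

Lemma rev_dbl w : rev (dbl w) = dbl (rev w).
Proof.
elim: w => //= b w IH; rewrite /dbl /= -/(dbl w) !rev_cons IH -!cats1 -catA.
by rewrite /dbl map_cat flatten_cat.
Qed.

Definition move i j : frag unit := drain i (fun b => push j b).

Definition dup_prog : frag bool :=
  seqf (move IO YS) (seqf (drain YS (fun b => seqf (push IO b) (push IO b)))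
    (seqf (push IO false) (seqf (push IO true) (ret true)))).

Lemma FP_enc_list1 : FP_word (fun x => enc_list [:: x]).
Proof.
apply: (@FP_word_compile dup_prog (fun n => (3 * n + 2) + ((4 * n + 2) + 3))).
- by repeat (apply det_bind || apply det_drain || intro).
- by exists 7, 1 => n; rewrite expn1; lia.
move=> x; exists true, [:: true :: false :: dbl (rev x); [::]; [::]; [::]; [::]; [::]; [::]; [::]].
split; last by rewrite /enc_list /= cats0 rev_cat rev_dbl.
apply: (exec_seq (s' := [:: [::]; [::]; [::]; [::]; [::]; [::]; [::]; x])).
  have := @exec_drain IO (push YS)
    (fun w p => [:: w; [::]; [::]; [::]; [::]; [::]; [::]; p]) 1 (rev x) [::].
  by rewrite cats0 revK size_rev; apply.
apply: (exec_seq (s' := [:: dbl (rev x); [::]; [::]; [::]; [::]; [::]; [::]; [::]])).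
  have := @exec_drain YS (fun b => seqf (push IO b) (push IO b))
    (fun w p => [:: dbl p; [::]; [::]; [::]; [::]; [::]; [::]; w]) 2 x [::].
  by rewrite cats0; apply.
by apply: (@exec_seq _ _ _ _ _ 1 2); [|apply: (@exec_seq _ _ _ _ _ 1 1)].
Qed.

Lemma inP_last : inP (fun w => last false w).
Proof.
pose F := bind (pop IO) (fun a => ret (a == Some true)).
have H x : cnt F (start_store x) 2 (last false x).
  exists [:: (last false x, put (start_store x) IO (behead (rev x)))]; last by rewrite /= addn0.
  apply: (@exec_seq _ _ _ _ _ 1 1); first exact: exec_pop.
  have -> : last false x = (ohead (rev x) == Some true); last exact: exec_ret.
  by case/lastP: x => // w b; rewrite last_rcons rev_rcons; case: b.
exists (compile F), (fun n => compile_time n 2); split.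
- by apply: compile_det; apply: det_bind.
- by apply: poly_compile_time; apply: poly_const.
- by move=> x; have [] := compile_cnt (H x) (leqnn _).
- by move=> x; have [_ ->] := compile_cnt (H x) (leqnn _); case: (last _ _).
Qed.

Lemma NP_sub_PNPpar L : inNP L -> inPNPpar L.
Proof.
move=> LNP; have [M [T [_ _ HL]]] := LNP.
(* The input is its own single query, and the answer is the last bit of the encoded pair. *)
exists (fun x => [:: x]), L, (fun w => last false w); split=> //.
- exact: FP_enc_list1.
- exact: inP_last.
move=> x; exists [:: 0 < nacc (T (size x)) (init M x)]; split=> //; split.
  by case=> // _; apply: HL.
by rewrite HL /enc_pair catA last_cat.
Qed.

(** * Products of path counts *)

Definition yields (f : frag bool) s t s' n :=
  exists2 bs, exec f s t [seq (b, s') | b <- bs] & count id bs = n.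

Definition guard (f g : frag bool) : frag bool :=
  bind f (fun b => if b then g else ret false).

Lemma sumn_count n (bs : seq bool) : sumn [seq if b then n else 0 | b <- bs] = count id bs * n.
Proof. by elim: bs => //= -[] bs ->; rewrite ?mulSn. Qed.

(** All paths of [f] end in the common store [s'], so each accepting one is continued by the same
    number [n2] of accepting paths. *)
Lemma cnt_guard f g s s' t1 t2 n1 n2 : yields f s t1 s' n1 -> cnt g s' t2 n2 ->
  cnt (guard f g) s (t1 + t2.+1) (n1 * n2).
Proof.
move=> [bs ef <-] hg; rewrite -sumn_count.
apply: cnt_bind ef _ => -[] _; first exact: cnt_mono hg.
apply: (@cnt_mono _ _ 1) => //; exists [:: (false, s')] => //; exact: exec_ret.
Qed.

Lemma exec_yields f s s1 s' t1 t2 n (X : finType) (h : frag X) x :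
  exec h s t1 [:: (x, s1)] -> yields f s1 t2 s' n -> yields (seqf h f) s (t1 + t2) s' n.
Proof. by move=> eh [bs ef e]; exists bs => //; apply: exec_seq eh ef. Qed.

Lemma yields_call M io rest x t : halts_within t (init M x) -> size rest = 5 ->
  yields (call M) (io :: [::] :: tape_bits (map Some x) :: rest) (call_time (size x) t)
    (io :: [::] :: [::] :: rest) (nacc t (init M x)).
Proof.
move=> h sr; exists (map (@accepting M) (leaves t (init M x))).
  by rewrite -map_comp; apply: exec_call.
by rewrite count_map -count_leaves; apply: eq_count.
Qed.

(** * Outputs of a machine, and binary numbers as path counts *)

Section Output.
Variable M : NTM.

Definition extract_body (_ : unit) : frag (unit + unit)%type :=
  bind (popsym TR) (fun a =>
    if a is Some b then seqf (push YS b) (ret (inl tt)) else ret (inr tt)).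
Definition extract : frag unit := loop extract_body tt.

(** What lies on the tape beyond the output is left unspecified as [w']; it will be cleared, and
    only its size enters the running time. The output arrives with its last bit on top. *)
Lemma exec_extract io tl xs ws zs a ys w : exists2 w', size w' <= size w &
  exec extract [:: io; tl; tape_bits w; xs; ws; zs; a; ys] (4 * size w + 3)
    [:: (tt, [:: io; tl; tape_bits w'; xs; ws; zs; a; rev (bits_until_blank w) ++ ys])].
Proof.
elim: w ys => [|[b|] w IH] ys.
- by exists [::] => //; apply: (@exec_mono _ _ _ 3) => //; apply: exec_loop_exit.
- have [w' hw e] := IH (b :: ys); exists w'; first exact: leqW.
  rewrite /= mulnS -addnA rev_cons cat_rcons.
  apply: exec_loop_next e.
  apply: (@exec_seq _ _ _ _ _ 2 2); first exact: (@exec_popsym TR _ (Some b) w).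
  by apply: (@exec_seq _ _ _ _ _ 1 1); [apply: exec_push|apply: exec_ret].
- exists w => //; apply: (@exec_mono _ _ _ 3); first exact: leq_addl.
  apply: exec_loop_exit.
  by apply: (@exec_seq _ _ _ _ _ 2 1); [apply: (@exec_popsym TR _ None w)|apply: exec_ret].
Qed.

Definition call_out : frag unit :=
  seqf (sim M) (seqf extract (seqf (clear TL) (clear TR))).

Lemma size_bits_until_blank w : size (bits_until_blank w) <= size w.
Proof. by elim: w => [|[b|] w IH] //=; rewrite ltnS. Qed.

Lemma size_output t x : deterministic M -> halts_within t (init M x) ->
  size (output (drun t (init M x))) <= (size x + t).+1.
Proof.
move=> dM h; have : drun t (init M x) \in leaves t (init M x).
  by rewrite (leaves_det dM h) mem_head.
move=> /tape_size_leaves hs; have {hs} := leq_trans hs (leq_add (tape_size_init M x) (leqnn t)).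
case: (drun _ _) => [[[q l] a] r] hs; apply: leq_trans (size_bits_until_blank (a :: r)) _.
by rewrite /= ltnS; apply: leq_trans hs; apply: leq_addl.
Qed.

Definition call_out_time (n t : nat) := 30 * (n + t) + 60.

Lemma exec_call_out io xs ws zs a ys x t : deterministic M -> halts_within t (init M x) ->
  exec call_out [:: io; [::]; tape_bits (map Some x); xs; ws; zs; a; ys] (call_out_time (size x) t)
    [:: (tt, [:: io; [::]; [::]; xs; ws; zs; a; rev (output (drun t (init M x))) ++ ys])].
Proof.
move=> dM h; have := exec_sim io [:: xs; ws; zs; a; ys] h; rewrite (leaves_det dM h) /=.
have : drun t (init M x) \in leaves t (init M x) by rewrite (leaves_det dM h) mem_head.
move=> /tape_size_leaves hs; have {hs} := leq_trans hs (leq_add (tape_size_init M x) (leqnn t)).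
case: (drun _ _) => [[[q l] c] r] hs H.
have [w' hw he] := exec_extract io (tape_bits l) xs ws zs a ys (c :: r).
have hr : size (c :: r) <= (size x + t).+1.
  by rewrite /= ltnS; apply: leq_trans hs; apply: leq_addl.
have hl : size (tape_bits l) <= 2 * (size x + t).
  by apply: leq_trans (size_tape_bits _) _; rewrite leq_mul2l; apply: leq_trans hs; apply: leq_addr.
have hw' : size (tape_bits w') <= 2 * (size x + t).+1.
  by apply: leq_trans (size_tape_bits _) _; rewrite leq_mul2l; apply: leq_trans hw hr.
set n1 := size (tape_bits l) in hl *; set n2 := size (tape_bits w') in hw' *.
apply: (@exec_mono _ _ _ ((10 * t + 14) + ((4 * size (c :: r) + 3) + ((3 * n1 + 2) + (3 * n2 + 2))))).
  by rewrite /call_out_time; lia.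
apply: exec_seq; first exact: H.
apply: exec_seq; first exact: he.
by apply: exec_seq; [apply: exec_clear|apply: exec_clear].
Qed.

End Output.

(* Reads a number from its lowest bit on: the flag tells whether the bit that is
   to be accounted for has been selected, and each lower bit doubles the paths. *)
Definition count_body (c : bool) : frag (bool + bool)%type :=
  bind (pop YS) (fun a =>
    if a is Some b then
      bind (guess (if c then [:: true] else false :: false :: (if b then [:: true] else [::])))
        (fun c => ret (inl c))
    else ret (inr c)).
Definition count_bits : frag bool := loop count_body false.

Lemma yields_count_loop c io tl tr xs ws zs a w :
  yields (loop count_body c) [:: io; tl; tr; xs; ws; zs; a; w] (3 * size w + 2)
    [:: io; tl; tr; xs; ws; zs; a; [::]] (if c then 1 else nat_of_bits (rev w)).
Proof.
set s := fun w => [:: io; tl; tr; xs; ws; zs; a; w].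
elim: w c => [|b w IH] c.
  exists [:: c]; last by case: c.
  by apply: (@exec_mono _ _ _ 2) => //; apply: exec_loop_exit.
pose cs := if c then [:: true] else false :: false :: (if b then [:: true] else [::]).
have E : exec (count_body c) (s (b :: w)) 3 (flatten [seq [:: (inl c', s w)] | c' <- cs]).
  apply: (@exec_seq _ _ _ _ _ 1 2); first exact: exec_pop.
  by apply: exec_guess_bind => c' _; apply: exec_ret.
have [bs0 E0 e0] := IH false; have [bs1 E1 e1] := IH true.
pose h (c' : bool) := if c' then bs1 else bs0.
exists (flatten (map h cs)).
  rewrite map_flatten -map_comp mulnS -addnA.
  have := exec_loop E; rewrite flatten_map1 => /(_ (3 * size w + 2)
    (fun y => if y.1 is inl c' then [seq (b, s [::]) | b <- h c'] else [::])).
  rewrite -map_comp; apply=> y /mapP [c' _ ->] /=; rewrite /h.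
  by case: c'.
rewrite count_flatten -map_comp rev_cons nat_of_bits_rcons.
by rewrite /cs; case: c {cs E}; case: b; rewrite /= ?e0 ?e1 -?addnn; lia.
Qed.

(** * Lists with a member in an NP set *)

(* Both functions read the reversal of an [enc_list]: the terminator of an item
   is then the pair [true; false], and it precedes the (reversed) item. *)
Fixpoint items (w : word) : seq word :=
  if w is b1 :: b2 :: w' then (if b1 != b2 then [:: w'] else [::]) ++ items w' else [::].

Fixpoint decode (w p : word) : word :=
  if w is b1 :: b2 :: w' then if b1 == b2 then decode w' (b1 :: p) else p else p.

Lemma items_dbl w v : items (dbl w ++ v) = items v.
Proof. by elim: w => //= b w IH; rewrite eqxx. Qed.

Lemma decode_dbl w v p : decode (dbl w ++ v) p = decode v (rev w ++ p).
Proof. by elim: w p => //= b w IH p; rewrite eqxx IH rev_cons cat_rcons. Qed.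

Lemma enc_list_cons w ws : enc_list (w :: ws) = dbl w ++ [:: false, true & enc_list ws].
Proof. by rewrite /enc_list /= -catA. Qed.

Lemma enc_list_rcons ws w : enc_list (rcons ws w) = enc_list ws ++ dbl w ++ [:: false; true].
Proof. by rewrite /enc_list map_rcons -cats1 flatten_cat /= cats0. Qed.

(** The input stack presents the encoding backwards, so the items come in reverse order. Each item
    is restored to its own order, since [decode] pushes its bits one by one. *)
Lemma items_enc_list ws :
  [seq decode v [::] | v <- items (rev (enc_list ws))] = rev ws.
Proof.
elim/last_ind: ws => // ws w IH.
rewrite enc_list_rcons !rev_cat rev_dbl rev_rcons /= items_dbl IH decode_dbl revK cats0.
congr cons; case/lastP: ws {IH} => // ws v.
by rewrite enc_list_rcons !rev_cat.
Qed.

Lemma pair_ind (P : word -> Prop) : P [::] -> (forall b, P [:: b]) ->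
  (forall b1 b2 w, P w -> P (b1 :: b2 :: w)) -> forall w, P w.
Proof.
move=> h0 h1 h2 w; suff: P w /\ forall b, P (b :: w) by case.
by elim: w => [|b w [IH1 IH2]]; split=> // b'; apply: h2.
Qed.

Definition scan_body (_ : unit) : frag (unit + bool)%type :=
  bind (pop IO) (fun a => if a is Some b1 then
    bind (pop IO) (fun a => if a is Some b2 then
      guess (if b1 != b2 then [:: inr true; inl tt] else [:: inl tt])
    else ret (inr false))
  else ret (inr false)).
Definition scan : frag bool := loop scan_body tt.

Lemma exec_scan w rest : exec scan (w :: rest) (3 * size w + 3)
  (rcons [seq (true, v :: rest) | v <- items w] (false, [::] :: rest)).
Proof.
elim/pair_ind: w => [|b|b1 b2 w IH].
- by apply: (@exec_mono _ _ _ 2) => //; apply: exec_loop_exit.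
- by apply: (@exec_mono _ _ _ 3) => //; apply: exec_loop_exit.
set xs : seq (unit + bool) := if b1 != b2 then [:: inr true; inl tt] else [:: inl tt].
have E : exec (scan_body tt) ((b1 :: b2 :: w) :: rest) 3 [seq (x, w :: rest) | x <- xs].
  apply: (@exec_seq _ _ _ _ _ 1 2); first exact: exec_pop.
  by apply: (@exec_seq _ _ _ _ _ 1 1); [apply: exec_pop|apply: exec_guess].
apply: (@exec_mono _ _ _ (3 + (3 * size w + 3))); first by rewrite /=; lia.
pose o := rcons [seq (true, v :: rest) | v <- items w] (false, [::] :: rest).
have := @exec_loop _ _ scan_body tt _ _ (3 * size w + 3) _
  (fun y => if y.1 is inr b then [:: (b, y.2)] else o) E.
rewrite -map_comp.
have -> : rcons [seq (true, v :: rest) | v <- items [:: b1, b2 & w]] (false, [::] :: rest) =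
  flatten [seq (if x is inr b then [:: (b, w :: rest)] else o) | x <- xs].
  by rewrite /= /xs; case: ifP => _ /=; rewrite cats0.
apply=> y /mapP [[[]|b] _ ->] //=; exact: IH.
Qed.

Definition take_body (_ : unit) : frag (unit + unit)%type :=
  bind (pop IO) (fun a => if a is Some b1 then
    bind (pop IO) (fun a => if a == Some b1 then
      seqf (pushsym TR (Some b1)) (ret (inl tt))
    else ret (inr tt))
  else ret (inr tt)).
Definition take_item : frag unit := loop take_body tt.

Lemma exec_take w tl p rest : exists w',
  exec take_item (w :: tl :: tape_bits (map Some p) :: rest) (5 * size w + 3)
    [:: (tt, w' :: tl :: tape_bits (map Some (decode w p)) :: rest)].
Proof.
elim/pair_ind: w p => [|b|b1 b2 w IH] p.
- by exists [::]; apply: (@exec_mono _ _ _ 2) => //; apply: exec_loop_exit.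
- by exists [::]; apply: (@exec_mono _ _ _ 3) => //; apply: exec_loop_exit.
have [<-|ne] := eqVneq b1 b2.
  have [w' H] := IH (b1 :: p); exists w'.
  apply: (@exec_mono _ _ _ (5 + (5 * size w + 3))); first by rewrite /=; lia.
  rewrite /= eqxx; apply: exec_loop_next H.
  apply: (@exec_seq _ _ _ _ _ 1 4); first exact: exec_pop.
  apply: (@exec_seq _ _ _ _ _ 1 3); first exact: exec_pop.
  rewrite /= eqxx; apply: (@exec_seq _ _ _ _ _ 2 1); last exact: exec_ret.
  exact: (@exec_pushsym TR _ (Some b1) (map Some p)).
exists w; apply: (@exec_mono _ _ _ 3); first by rewrite /=; lia.
apply: exec_loop_exit; rewrite /= (negPf ne).
apply: (@exec_seq _ _ _ _ _ 1 2); first exact: exec_pop.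
apply: (@exec_seq _ _ _ _ _ 1 1); first exact: exec_pop.
have -> : (ohead (get (put [:: [:: b1, b2 & w], tl, tape_bits [seq Some i | i <- p] & rest] IO
   (behead (get [:: [:: b1, b2 & w], tl, tape_bits [seq Some i | i <- p] & rest] IO))) IO) == Some b1) = false.
  by rewrite /=; apply/eqP => -[] e; rewrite e eqxx in ne.
exact: exec_ret.
Qed.

Lemma size_decode w p : size (decode w p) <= size w + size p.
Proof.
elim/pair_ind: w p => //= b1 b2 w IH p; case: ifP => _; last by lia.
by apply: leq_trans (IH _) _; rewrite /=; lia.
Qed.

Lemma size_items w v : v \in items w -> size v <= size w.
Proof.
elim/pair_ind: w => //= b1 b2 w IH; rewrite mem_cat => /orP [|/IH]; last by lia.
by case: ifP => // _; rewrite inE => /eqP ->; lia.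
Qed.

(** The machine guesses an item and runs [M] on it, so accepting paths add up over the list and
    positivity means that some item is accepted. Words that are not encodings are also decoded to
    some list, which makes the function total. *)
Lemma sharp_items M c k : (forall x, halts_within (pol c k (size x)) (init M x)) ->
  sharp (fun w => sumn [seq nacc (pol c k (size v)) (init M v) |
                        v <- [seq decode u [::] | u <- items (rev w)]]).
Proof.
move=> hM.
pose F := bind scan (fun b => if b then seqf take_item (call M) else ret false).
pose T n := (3 * n + 3) + ((5 * n + 3) + call_time n (pol c k n)).
apply: (@sharp_compile F T).
  apply: poly_add; first by exists 3, 1 => n; rewrite expn1; lia.
  apply: poly_add; first by exists 5, 1 => n; rewrite expn1; lia.
  apply: poly_add; last exact: poly_const.
  apply: poly_mul; first exact: poly_const.
  by apply: poly_add; [apply: poly_id|apply: poly_pol].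
move=> x; pose rest := nseq 5 ([::] : word).
pose z (o : option word) := o != None.
pose s' (o : option word) : store := (if o is Some v then v else [::]) :: [::] :: [::] :: rest.
pose n (o : option word) :=
  if o is Some u then nacc (pol c k (size (decode u [::]))) (init M (decode u [::])) else 0.
pose l := rcons (map Some (items (rev x))) None.
have -> : sumn [seq nacc (pol c k (size v)) (init M v) | v <- [seq decode u [::] | u <- items (rev x)]]
    = sumn (map n l).
  by rewrite /l map_rcons -cats1 sumn_cat /= !addn0 -!map_comp.
apply: (@cnt_bind _ _ _ _ _ _ _ l z s' n).
  have := exec_scan (rev x) ([::] :: [::] :: rest).
  by rewrite size_rev /l map_rcons -map_comp.
move=> [u|]; rewrite /l mem_rcons inE => /orP [] //; last 1 first.
- by case/mapP.
- case/mapP => v /size_items; rewrite size_rev => hv [->] /=.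
  have [w' ht] := exec_take v [::] [::] rest.
  have hd : size (decode v [::]) <= size x.
    by apply: leq_trans hv; have := size_decode v [::]; rewrite addn0.
  apply: (@cnt_mono _ _ ((5 * size v + 3) + call_time (size (decode v [::])) (pol c k (size (decode v [::]))))).
    by have := pol_mono c k hd; rewrite /call_time; lia.
  apply: cnt_seq ht _.
  have [bs eb cb] := yields_call w' (hM (decode v [::])) (erefl : size rest = 5).
  exists [seq (b, w' :: [::] :: [::] :: rest) | b <- bs] => //.
  by rewrite count_map -cb; apply: eq_count.
move=> _; exists [:: (false, s' None)] => //.
by apply: (@exec_mono _ _ _ 1); [rewrite /call_time; lia|apply: exec_ret].
Qed.

(** * Squared gaps *)

Definition to_tape i j : frag unit :=
  drain i (fun b => seqf (pushsym TR (Some b)) (push j b)).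

(** A call consumes its tape, so the word on [ZS] is duplicated before every factor. *)
Definition copy_to_tape : frag unit := seqf (move ZS YS) (to_tape YS ZS).

Lemma exec_copy_to_tape io tl xs ws z a :
  exec copy_to_tape [:: io; tl; [::]; xs; ws; z; a; [::]] (8 * size z + 4)
    [:: (tt, [:: io; tl; tape_bits (map Some z); xs; ws; z; a; [::]])].
Proof.
apply: (@exec_mono _ _ _ ((1 + 2) * size z + 2 + ((3 + 2) * size z + 2))); first by lia.
apply: (exec_seq (s' := [:: io; tl; [::]; xs; ws; [::]; a; rev z])).
  have := @exec_drain ZS (push YS) (fun w p => [:: io; tl; [::]; xs; ws; w; a; p]) 1 z [::].
  by rewrite cats0; apply.
have := @exec_drain YS (fun b => seqf (pushsym TR (Some b)) (push ZS b))
  (fun w p => [:: io; tl; tape_bits (map Some p); xs; ws; p; a; w]) 3 (rev z) [::].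
by rewrite cats0 revK size_rev; apply.
Qed.

Section Gap.
Variables (MN MF : NTM) (tN tF : nat -> nat).
Hypotheses (tN_mono : {homo tN : m n / m <= n}) (tF_mono : {homo tF : m n / m <= n}).
Hypothesis hN : forall x, halts_within (tN (size x)) (init MN x).
Hypothesis hF : forall x, halts_within (tF (size x)) (init MF x).
Hypothesis dF : deterministic MF.

Definition accN x := nacc (tN (size x)) (init MN x).
Definition valF x := nat_of_bits (output (drun (tF (size x)) (init MF x))).

(* Every round multiplies the number of paths by [accN z - valF z], the paths
   through [MF] changing sign. *)
Fixpoint gap (n : nat) (s : bool) : frag bool :=
  if n is n'.+1 then
    bind (guess [:: true; false]) (fun c => seqf copy_to_tape
      (guard (if c then call MN else seqf (call_out MF) count_bits)
             (gap n' (if c then s else ~~ s))))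
  else ret s.

(** For [s = true] these are the positive terms of [(accN z - valF z) ^ n], for [s = false] the
    negative ones. When [n = 2] they are [c ^ 2 + v ^ 2] and [2 * c * v], with [c = accN z] and
    [v = valF z]. *)
Fixpoint gap_count (n : nat) (s : bool) (z : word) : nat :=
  if n is n'.+1 then accN z * gap_count n' s z + valF z * gap_count n' (~~ s) z else s.

Definition gap_time m := 8 * m + 4 + (call_time m (tN m) +
  (call_out_time m (tF m) + (3 * (m + tF m).+1 + 2))) + 2.

Lemma gap_time_mono m m' : m <= m' -> gap_time m <= gap_time m'.
Proof.
move=> h; have := tN_mono h; have := tF_mono h.
by rewrite /gap_time /call_time /call_out_time; lia.
Qed.

Lemma cnt_gap n s io xs ws z a :
  cnt (gap n s) [:: io; [::]; [::]; xs; ws; z; a; [::]] (n * gap_time (size z) + 1)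
    (gap_count n s z).
Proof.
set st0 := [:: io; [::]; [::]; xs; ws; z; a; [::]].
elim: n s => [|n IH] s.
  by exists [:: (s, st0)]; [apply: exec_ret|rewrite /= addn0].
pose sg (c : bool) := if c then s else ~~ s.
pose v (c : bool) := if c then accN z else valF z.
have -> : gap_count n.+1 s z = sumn [seq v c * gap_count n (sg c) z | c <- [:: true; false]].
  by rewrite /= addn0.
apply: (@cnt_mono _ _ (1 + ((8 * size z + 4) + ((call_time (size z) (tN (size z)) +
  (call_out_time (size z) (tF (size z)) + (3 * (size z + tF (size z)).+1 + 2))) +
  (n * gap_time (size z) + 1).+1)))).
  by rewrite mulSn /gap_time; lia.
apply: (@cnt_bind _ _ _ _ _ _ _ _ id (fun _ => st0)); first exact: exec_guess.
move=> c _; apply: cnt_seq; first exact: exec_copy_to_tape.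
apply: (cnt_guard (s' := st0)) (IH _).
case: c => /=.
  have [bs e1 e2] := yields_call io (hN z) (erefl : size [:: xs; ws; z; a; [::]] = 5).
  by exists bs => //; apply: exec_mono e1; apply: leq_addr.
have e := exec_call_out io xs ws z a [::] dF (hF z); rewrite cats0 in e.
have := exec_yields e (yields_count_loop false io [::] [::] xs ws z a _).
rewrite revK => -[bs e1 e2].
exists bs => //; apply: exec_mono e1; apply: leq_trans (leq_addl _ _).
rewrite leq_add2l leq_add2r leq_mul2l size_rev; exact: size_output.
Qed.

End Gap.

(** * Guessing the answers *)

Lemma size_dbl w : size (dbl w) = 2 * size w.
Proof. by elim: w => //= b w; rewrite /dbl /= => ->; lia. Qed.

Lemma size_enc_pair x y : size (enc_pair x y) = 2 * size x + 2 + size y.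
Proof. by rewrite /enc_pair !size_cat size_dbl /= addnA. Qed.

Section Paths.
Variables (MG MA MD MN MF : NTM) (tG tA tD tN tF : nat -> nat).
Hypotheses (mA : {homo tA : m n / m <= n}) (mD : {homo tD : m n / m <= n})
  (mN : {homo tN : m n / m <= n}) (mF : {homo tF : m n / m <= n}).
Hypothesis hG : forall x, halts_within (tG (size x)) (init MG x).
Hypothesis hA : forall x, halts_within (tA (size x)) (init MA x).
Hypothesis hD : forall x, halts_within (tD (size x)) (init MD x).
Hypothesis hN : forall x, halts_within (tN (size x)) (init MN x).
Hypothesis hF : forall x, halts_within (tF (size x)) (init MF x).
Hypotheses (dG : deterministic MG) (dD : deterministic MD) (dF : deterministic MF).

Definition accA q := nacc (tA (size q)) (init MA q).
Definition accD w := 0 < nacc (tD (size w)) (init MD w).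

(** [enc_pair] is laid on the tape from its end: answers, separator, doubled input. The latest
    answer is on top of [AS], so draining puts the answers in the order of the queries. *)
Definition decide : frag bool :=
  seqf (drain AS (fun b => pushsym TR (Some b)))
    (seqf (pushsym TR (Some true)) (seqf (pushsym TR (Some false))
      (seqf (drain IO (fun b => seqf (pushsym TR (Some b)) (pushsym TR (Some b))))
        (call MD)))).

Definition decide_time m := 10 * m + 8 + call_time (3 * m + 2) (tD (3 * m + 2)).

Lemma exec_decide x xs ws z a ys m : size x <= m -> size a <= m ->
  exec decide [:: rev x; [::]; [::]; xs; ws; z; a; ys] (decide_time m)
    [:: (accD (enc_pair x (rev a)), [:: [::]; [::]; [::]; xs; ws; z; [::]; ys])].
Proof.
move=> xm am; set y := enc_pair x (rev a).
have ym : size y <= 3 * m + 2 by rewrite size_enc_pair size_rev; lia.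
apply: (@exec_mono _ _ _ ((2 + 2) * size a + 2 + (2 + (2 + ((4 + 2) * size x + 2 +
  call_time (size y) (tD (size y))))))).
  by have := mD ym; rewrite /decide_time /call_time; lia.
apply: (exec_seq (s' := [:: rev x; [::]; tape_bits (map Some (rev a)); xs; ws; z; [::]; ys])).
  have := @exec_drain AS (fun b => pushsym TR (Some b))
    (fun w p => [:: rev x; [::]; tape_bits (map Some p); xs; ws; z; w; ys]) 2 a [::].
  by rewrite cats0; apply.
apply: exec_seq; first exact: (@exec_pushsym TR _ _ (map Some (rev a))).
apply: exec_seq; first exact: (@exec_pushsym TR _ _ (Some true :: map Some (rev a))).
apply: (exec_seq (s' := [:: [::]; [::]; tape_bits (map Some y); xs; ws; z; [::]; ys])).
  have := @exec_drain IO (fun b => seqf (pushsym TR (Some b)) (pushsym TR (Some b)))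
    (fun w p => [:: w; [::]; tape_bits (map Some (dbl p ++ [:: false; true] ++ rev a)); xs; ws; z; [::]; ys])
    4 (rev x) [::].
  by rewrite cats0 revK size_rev; apply.
exact: exec_call_det.
Qed.

Definition tail (s : bool) : frag bool :=
  bind decide (fun b => if b then ret false else gap MN MF 2 s).

Definition tail_count s x a z :=
  if accD (enc_pair x (rev a)) then 0 else gap_count MN MF tN tF 2 s z.

Definition tail_time m := decide_time m + (2 * gap_time tN tF m + 1).

Lemma cnt_tail s x xs ws z a m : size x <= m -> size a <= m -> size z <= m ->
  cnt (tail s) [:: rev x; [::]; [::]; xs; ws; z; a; [::]] (tail_time m) (tail_count s x a z).
Proof.
move=> xm am zm; apply: cnt_seq; first exact: exec_decide xm am.
rewrite /tail_count; case: ifP => _.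
  apply: (@cnt_mono _ _ 1); first exact: leq_addl.
  by exists [:: (false, [:: [::]; [::]; [::]; xs; ws; z; [::]; [::]])]; first exact: exec_ret.
apply: cnt_mono (cnt_gap hN hF dF 2 s _ _ _ _ _).
by have := gap_time_mono mN mF zm; lia.
Qed.

(** [WS] holds the unread queries, [YS] the current one reversed, [AS] the guessed answers, latest
    first, and [ZS] the encoded list of queries answered negatively. Two equal bits extend the
    current query; two distinct bits end it and trigger the guess of its answer, a positive one
    being certified by a run of [MA]. *)
Definition main_body (s : bool) (_ : unit) : frag (unit + bool)%type :=
  bind (pop WS) (fun o => match o with
  | None => bind (tail s) (fun b => ret (inr b))
  | Some b1 => bind (pop WS) (fun o =>
      if o == Some b1 then seqf (push YS b1) (ret (inl tt)) else
      bind (guess [:: true; false]) (fun c =>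
        if c then
          seqf (drain YS (fun b => pushsym TR (Some b)))
            (bind (call MA) (fun b =>
               if b then seqf (push AS true) (ret (inl tt)) else ret (inr false)))
        else
          seqf (push ZS true) (seqf (push ZS false)
            (seqf (drain YS (fun b => seqf (push ZS b) (push ZS b)))
              (seqf (push AS false) (ret (inl tt)))))))
  end).

Definition main_store x w y a z : store := [:: rev x; [::]; [::]; [::]; w; z; a; y].

Lemma cnt_main_end s x a z m : size x <= m -> size a <= m -> size z <= m ->
  cnt (loop (main_body s) tt) (main_store x [::] [::] a z) (tail_time m + 2)
    (tail_count s x a z).
Proof.
move=> xm am zm; have [o eo <-] := cnt_tail s [::] [::] xm am zm.
have -> : count fst o = sumn [seq nat_of_bool y.1 | y <- o] by elim: (o) => //= y l ->.
have -> : tail_time m + 2 = (1 + (tail_time m + 1)) + 0 by lia.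
apply: (@cnt_loop _ _ _ _ _ _ _ _ (fun y => inr y.1) snd) => //.
apply: exec_seq; first exact: exec_pop.
rewrite -flatten_map1; apply: exec_bind; first exact: eo.
by move=> y _; apply: exec_ret.
Qed.

Lemma cnt_main_read s x w y a z q t n :
  cnt (loop (main_body s) tt) (main_store x w (rev q ++ y) a z) t n ->
  cnt (loop (main_body s) tt) (main_store x (dbl q ++ w) y a z) (4 * size q + t) n.
Proof.
elim: q y => //= b q IH y; rewrite rev_cons cat_rcons => /IH H.
rewrite mulnS -addnA; apply: cnt_loop_next H.
apply: (@exec_seq _ _ _ _ _ 1 3); first exact: exec_pop.
apply: (@exec_seq _ _ _ _ _ 1 2); first exact: exec_pop.
rewrite [ohead _]/= eqxx.
by apply: (@exec_seq _ _ _ _ _ 1 1); [apply: exec_push|apply: exec_ret].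
Qed.

Definition query_time m := call_time m (tA m) + 4 * m + 10.

Lemma query_time_mono m m' : m <= m' -> query_time m <= query_time m'.
Proof. by move=> h; have := mA h; rewrite /query_time /call_time; lia. Qed.

Lemma cnt_main_query s x w a z q t n1 n2 :
  cnt (loop (main_body s) tt) (main_store x w [::] (true :: a) z) t n1 ->
  cnt (loop (main_body s) tt) (main_store x w [::] (false :: a) (dbl q ++ [:: false, true & z])) t n2 ->
  cnt (loop (main_body s) tt) (main_store x [:: false, true & w] (rev q) a z)
    (query_time (size q) + t) (accA q * n1 + n2).
Proof.
move=> h1 h2.
have [bs ebs cbs] := yields_call (rev x) (hA q) (erefl : size [:: [::]; w; z; a; [::]] = 5).
(* [Some b] stands for a path of [MA] that returns [b], and [None] for a guessed negative answer. A
   positive guess whose certificate fails has weight 0. *)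
pose l := map Some bs ++ [:: None].
pose nxt (o : option bool) : (unit + bool)%type := if o is Some false then inr false else inl tt.
pose st (o : option bool) := match o with
  | Some true => main_store x w [::] (true :: a) z
  | Some false => main_store x w [::] a z
  | None => main_store x w [::] (false :: a) (dbl q ++ [:: false, true & z]) end.
pose n (o : option bool) := match o with Some true => n1 | Some false => 0 | None => n2 end.
have -> : accA q * n1 + n2 = sumn (map n l).
  rewrite /l map_cat sumn_cat /= addn0 -map_comp /accA -cbs -sumn_count.
  by congr (_ + _); congr sumn; apply: eq_map => -[].
apply: (@cnt_loop _ _ _ _ _ _ _ l nxt st n); last by move=> [[]|] _ //=; rewrite /nxt.
have -> : query_time (size q) = 1 + (1 + (call_time (size q) (tA (size q)) + 4 * size q + 7).+1).
  by rewrite /query_time; lia.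
apply: exec_seq; first exact: exec_pop.
apply: exec_seq; first exact: exec_pop.
have -> : [seq (nxt i, st i) | i <- l] = flatten [seq (if c then [seq (nxt (Some b), st (Some b)) | b <- bs]
     else [:: (nxt None, st None)]) | c <- [:: true; false]].
  by rewrite /= /l map_cat -map_comp.
apply: exec_guess_bind => -[] _.
  apply: (@exec_mono _ _ _ (((2 + 2) * size q + 2) + (call_time (size q) (tA (size q)) + 2))).
    by lia.
  apply: (exec_seq (s' := [:: rev x; [::]; tape_bits (map Some q); [::]; w; z; a; [::]])).
    have := @exec_drain YS (fun b => pushsym TR (Some b))
      (fun v p => [:: rev x; [::]; tape_bits (map Some p); [::]; w; z; a; v]) 2 (rev q) [::].
    by rewrite cats0 revK size_rev; apply.
  have := @exec_bind _ _ _ (fun b : bool => if b then seqf (push AS true) (ret (inl tt)) else ret (inr false))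
    _ _ 2 _ (fun y => [:: (nxt (Some y.1), st (Some y.1))]) ebs.
  rewrite flatten_map1 -map_comp; apply=> _ /mapP [[] _ ->] /=.
    by apply: (@exec_seq _ _ _ _ _ 1 1); [apply: exec_push|apply: exec_ret].
  by apply: (@exec_mono _ _ _ 1) => //; apply: exec_ret.
apply: (@exec_mono _ _ _ (1 + (1 + (((2 + 2) * size q + 2) + 2)))); first by lia.
apply: exec_seq; first exact: exec_push.
apply: exec_seq; first exact: exec_push.
apply: (exec_seq (s' := main_store x w [::] a (dbl q ++ [:: false, true & z]))).
  have := @exec_drain YS (fun b => seqf (push ZS b) (push ZS b))
    (fun v p => main_store x w v a (dbl p ++ [:: false, true & z])) 2 (rev q) [::].
  by rewrite cats0 revK size_rev; apply.
by apply: (@exec_seq _ _ _ _ _ 1 1); [apply: exec_push|apply: exec_ret].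
Qed.

Fixpoint main_count s x qs a zs : nat :=
  if qs is q :: qs' then
    accA q * main_count s x qs' (true :: a) zs + main_count s x qs' (false :: a) (q :: zs)
  else tail_count s x a (enc_list zs).

(** A query read from [qs] moves to [zs] or disappears, and it yields one answer bit, so neither of
    the two sums of sizes ever grows: one [m] bounds the stacks throughout. *)
Lemma cnt_main_loop s x qs a zs m :
  size x <= m -> size (enc_list qs) + size a <= m ->
  size (enc_list qs) + size (enc_list zs) <= m ->
  cnt (loop (main_body s) tt) (main_store x (enc_list qs) [::] a (enc_list zs))
    (query_time m * size (enc_list qs) + (tail_time m + 2)) (main_count s x qs a zs).
Proof.
elim: qs a zs => [|q qs IH] a zs xm am zm.
  by rewrite muln0; apply: cnt_main_end.
move: am zm; rewrite !enc_list_cons !size_cat size_dbl /= => am zm.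
have h1 : cnt (loop (main_body s) tt)
    (main_store x (enc_list qs) [::] (true :: a) (enc_list zs))
    (query_time m * size (enc_list qs) + (tail_time m + 2)) (main_count s x qs (true :: a) zs).
  by apply: IH => //=; lia.
have h2 : cnt (loop (main_body s) tt)
    (main_store x (enc_list qs) [::] (false :: a) (enc_list (q :: zs)))
    (query_time m * size (enc_list qs) + (tail_time m + 2)) (main_count s x qs (false :: a) (q :: zs)).
  by apply: IH => //; rewrite ?enc_list_cons ?size_cat ?size_dbl /=; lia.
rewrite enc_list_cons in h2.
apply: (@cnt_mono _ _ (4 * size q + (query_time (size q) + (query_time m * size (enc_list qs) + (tail_time m + 2))))).
  have : query_time (size q) <= query_time m by apply: query_time_mono; lia.
  have : 10 <= query_time m by rewrite /query_time; lia.
  by nia.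
by apply: cnt_main_read; rewrite cats0; apply: cnt_main_query.
Qed.

Definition main (s : bool) : frag bool :=
  seqf (to_tape IO XS) (seqf (move XS IO) (seqf (call_out MG) (seqf (move YS WS)
    (loop (main_body s) tt)))).

Definition main_time n :=
  let m := n + (n + tG n).+1 in
  (5 * n + 2) + ((3 * n + 2) + (call_out_time n (tG n) + ((3 * m + 2) +
    (query_time m * m + (tail_time m + 2))))).

Lemma cnt_main s x qs : output (drun (tG (size x)) (init MG x)) = enc_list qs ->
  cnt (main s) (start_store x) (main_time (size x)) (main_count s x qs [::] [::]).
Proof.
move=> eG; have := size_output dG (hG x); rewrite eG => hs.
set m := size x + (size x + tG (size x)).+1.
apply: (@cnt_mono _ _ ((5 * size x + 2) + ((3 * size x + 2) + (call_out_time (size x) (tG (size x)) +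
   ((3 * size (enc_list qs) + 2) + (query_time m * size (enc_list qs) + (tail_time m + 2))))))).
  have hm : size (enc_list qs) <= m by rewrite /m; lia.
  have : query_time m * size (enc_list qs) <= query_time m * m by rewrite leq_mul2l hm orbT.
  by rewrite /main_time -/m; lia.
apply: (cnt_seq (s' := [:: [::]; [::]; tape_bits (map Some x); x; [::]; [::]; [::]; [::]])).
  have := @exec_drain IO (fun b => seqf (pushsym TR (Some b)) (push XS b))
    (fun w p => [:: w; [::]; tape_bits (map Some p); p; [::]; [::]; [::]; [::]]) 3 (rev x) [::].
  by rewrite cats0 revK size_rev; apply.
apply: (cnt_seq (s' := [:: rev x; [::]; tape_bits (map Some x); [::]; [::]; [::]; [::]; [::]])).
  have := @exec_drain XS (push IO)
    (fun w p => [:: p; [::]; tape_bits (map Some x); w; [::]; [::]; [::]; [::]]) 1 x [::].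
  by rewrite cats0; apply.
apply: cnt_seq; first exact: exec_call_out.
rewrite eG cats0.
apply: (cnt_seq (s' := main_store x (enc_list qs) [::] [::] (enc_list [::]))).
  have := @exec_drain YS (push WS)
    (fun w p => [:: rev x; [::]; [::]; [::]; p; [::]; [::]; w]) 1 (rev (enc_list qs)) [::].
  by rewrite cats0 revK size_rev; apply.
by apply: cnt_main_loop; rewrite /= ?addn0 /m; lia.
Qed.

End Paths.

(** * The two inclusions *)

Lemma FP_word_pol f : FP_word f -> exists (M : NTM) c k, deterministic M /\
  forall x, halts_within (pol c k (size x)) (init M x) /\
    output (drun (pol c k (size x)) (init M x)) = f x.
Proof.
move=> [M [T [dM [c [k pT]] rM oM]]]; exists M, c, k; split=> // x.
by have [h _ ->] := run_stable (pT (size x)) (rM x).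
Qed.

Lemma NTM_pol M T (L : language) : poly_bound T -> runs_in M T ->
  (forall x, L x <-> 0 < nacc (T (size x)) (init M x)) ->
  exists c k, forall x, halts_within (pol c k (size x)) (init M x) /\
    (L x <-> 0 < nacc (pol c k (size x)) (init M x)).
Proof.
move=> [c [k pT]] rM HL; exists c, k => x.
by have [h -> _] := run_stable (pT (size x)) (rM x).
Qed.

Lemma inNP_sharp h : sharp h -> inNP (fun x => 0 < h x).
Proof.
move=> [M [c [k H]]]; exists M, (pol c k); split; first exact: poly_pol.
  by move=> x; have [] := H x.
by move=> x; rewrite (H x).2.
Qed.

Lemma poly_linear a b T : poly_bound T -> poly_bound (fun n => a * T n + b).
Proof.
by move=> pT; apply: poly_add; [apply: poly_mul => //|]; apply: poly_const.
Qed.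

Lemma poly_call_time T U : poly_bound T -> poly_bound U ->
  poly_bound (fun n => call_time (T n) (U (T n))).
Proof. by move=> pT pU; apply/poly_linear/poly_add => //; apply: poly_comp. Qed.

Lemma poly_main_time tG tA tD tN tF : poly_bound tG -> poly_bound tA -> poly_bound tD ->
  poly_bound tN -> poly_bound tF -> poly_bound (main_time tG tA tD tN tF).
Proof.
move=> pG pA pD pN pF; have pid := poly_id.
have pm : poly_bound (fun n => n + (n + tG n).+1).
  apply: poly_add => //; apply: (poly_le (T' := fun n => 1 * (n + tG n) + 1)) => [n|]; first by lia.
  by apply: poly_linear; apply: poly_add.
have pq : poly_bound (query_time tA).
  apply: poly_add; last exact: poly_const.
  by apply: poly_add; [apply: poly_call_time|apply: poly_mul => //; apply: poly_const].
have pt : poly_bound (tail_time tD tN tF).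
  apply: poly_add.
    apply: poly_add; first exact: poly_linear.
    by apply: (@poly_call_time (fun m => 3 * m + 2)) => //; apply: poly_linear.
  apply: poly_linear; apply: poly_add; last exact: poly_const.
  apply: poly_add; first exact: poly_linear.
  apply: poly_add; first exact: poly_call_time.
  apply: poly_add; first by apply: poly_linear; apply: poly_add.
  apply: (poly_le (T' := fun n => 3 * (n + tF n) + 5)) => [n|]; first by lia.
  by apply: poly_linear; apply: poly_add.
apply: poly_add; first exact: poly_linear.
apply: poly_add; first exact: poly_linear.
apply: poly_add; first by apply: poly_linear; apply: poly_add.
apply: poly_add; first exact: poly_linear.
apply: poly_add; first by apply: poly_mul => //; apply: poly_comp pm.
by apply: poly_add; [apply: (poly_comp pt pm)|apply: poly_const].
Qed.

Section Decision.
Variables (MA MD MN MF : NTM) (tA tD tN tF : nat -> nat).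
Local Notation a := (accA MA tA).
Local Notation c := (accN MN tN).
Local Notation v := (valF MF tF).
Local Notation count := (main_count MA MD MN MF tA tD tN tF).

(** This is [2 * c * v <= c ^ 2 + v ^ 2] with its equality case. *)
Lemma gap_count2 z :
  gap_count MN MF tN tF 2 false z <= gap_count MN MF tN tF 2 true z ?= iff (c z == v z).
Proof.
have := nat_Cauchy (c z) (v z); rewrite /= !muln0 !muln1 !addn0 !add0n.
by rewrite [v z * c z]mulnC addnn -mul2n -!mulnn.
Qed.

(** The equality case of [gap_count2], propagated through the recursion of [main_count]: a positive
    branch imposes its condition only if its weight [a q] is nonzero. *)
Fixpoint consistent x qs ans zs : bool :=
  if qs is q :: qs' then
    ((0 < a q) ==> consistent x qs' (true :: ans) zs) && consistent x qs' (false :: ans) (q :: zs)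
  else accD MD tD (enc_pair x (rev ans)) || (c (enc_list zs) == v (enc_list zs)).

Lemma main_count_leif x qs ans zs :
  count false x qs ans zs <= count true x qs ans zs ?= iff consistent x qs ans zs.
Proof.
elim: qs ans zs => [|q qs IH] ans zs /=.
  rewrite /tail_count; case: ifP => _ /=; first exact: leqif_refl.
  exact: gap_count2.
apply: leqif_add => //; have [h e] := IH (true :: ans) zs; split; first by rewrite leq_mul2l h orbT.
by rewrite eqn_mul2l e; case: (a q).
Qed.

Hypothesis cE : forall zs, (c (enc_list zs) == v (enc_list zs)) = has (fun z => 0 < a z) zs.

(** At each query the wrong branch is automatically satisfied: a negative answer to a member of [A]
    puts a member on the list, and a positive answer to a nonmember has weight 0. Only the branch
    with the true answers can fail. *)
Lemma consistentE x qs ans zs : consistent x qs ans zs =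
  has (fun z => 0 < a z) zs || accD MD tD (enc_pair x (rev ans ++ [seq 0 < a q | q <- qs])).
Proof.
elim: qs ans zs => [|q qs IH] ans zs /=; first by rewrite cE orbC cats0.
rewrite !IH /= !rev_cons !cat_rcons.
by case: (0 < a q) => //=; rewrite ?andbT.
Qed.

End Decision.

Lemma PNPpar_sub_CeqP : (forall L, inNP L -> inCeqP L) -> forall L, inPNPpar L -> inCeqP L.
Proof.
move=> NPC L [g [A [D [/FP_word_pol [MG [cG [kG [dG HG]]]] [MA [TA [pA rA LA]]] [MD [TD [dD pD rD LD]]] HL]]]].
have [cA [kA HA]] := NTM_pol pA rA LA.
have [cD [kD HD]] := NTM_pol pD rD LD.
(* The assumption on NP is used here, for the language of lists with a member in [A]; it provides
   the machine [MN] behind [c] and the machine [MF] that computes [v]. *)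
have /inNP_sharp/NPC [f [MN [TN [[gf [/FP_word_pol [MF [cF [kF [dF HF]]]] Hgf]] pN rN LN]]]] :=
  sharp_items (fun x => (HA x).1).
have [cN [kN HN]] : exists cN kN, forall x, halts_within (pol cN kN (size x)) (init MN x) /\
    nacc (TN (size x)) (init MN x) = nacc (pol cN kN (size x)) (init MN x).
  case: pN => [cN [kN pN]]; exists cN, kN => x.
  by have [h -> _] := run_stable (pN (size x)) (rN x).
pose h s x := main_count MA MD MN MF (pol cA kA) (pol cD kD) (pol cN kN) (pol cF kF) s x (g x) [::] [::].
have hs s : sharp (h s).
  apply: (@sharp_compile (main MG MA MD MN MF s)
    (main_time (pol cG kG) (pol cA kA) (pol cD kD) (pol cN kN) (pol cF kF))).
    by apply: poly_main_time; apply: poly_pol.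
  move=> x; apply: cnt_main => //; try exact: pol_mono.
  - by move=> y; have [] := HG y.
  - by move=> y; have [] := HA y.
  - by move=> y; have [] := HD y.
  - by move=> y; have [] := HN y.
  - by move=> y; have [] := HF y.
  - by have [] := HG x.
apply: (ceqP_sharp (hs false) (hs true)) => x.
have cE zs : (accN MN (pol cN kN) (enc_list zs) == valF MF (pol cF kF) (enc_list zs)) =
    has (fun z => 0 < accA MA (pol cA kA) z) zs.
  rewrite /accN /valF -(HN _).2 (HF _).2 Hgf.
  have -> : has (fun z => 0 < accA MA (pol cA kA) z) zs =
    (0 < sumn [seq accA MA (pol cA kA) z | z <- rev zs]).
    rewrite -has_rev; elim: (rev zs) => //= z l ->; by rewrite addn_gt0.
  rewrite -items_enc_list; apply/eqP/idP => /LN //.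
have [_ e] := main_count_leif MA MD MN MF (pol cA kA) (pol cD kD) (pol cN kN) (pol cF kF) x (g x) [::] [::].
have [ans [sa [ha ->]]] := HL x.
have -> : ans = [seq 0 < accA MA (pol cA kA) q | q <- g x].
  apply: (@eq_from_nth _ false); first by rewrite size_map.
  move=> i hi; rewrite (nth_map [::]) -?sa //; apply/idP/idP.
    by move/(ha i hi); rewrite (HA _).2.
  by move=> hq; apply/(ha i hi); rewrite (HA _).2.
rewrite consistentE // orFb cat0s in e.
by rewrite (HD _).2 -/(accD MD (pol cD kD) _) -e; split=> /eqP.
Qed.

Theorem theorem1 :
  (forall L : language, inNP L -> inCeqP L) <->
  (forall L : language, inPNPpar L -> inCeqP L).
Proof.
by split=> [/PNPpar_sub_CeqP //|H L /NP_sub_PNPpar]; apply: H.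
Qed.
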